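(* Let $V$ be a unitary irreducible lowest weight representation of the open string algebra $\hat{G}_{\Lambda,\Lambda_F}$. Then $V$ is isomorphic to a tensor product $V_1\otimes V_2$ (each $X\in\hat{G}_{\Lambda,\Lambda_F}$ acting as $X\otimes1+1\otimes X$), where $V_1$ is a unitary irreducible lowest weight representation whose lowest weight is approximately finite, and $V_2$ is a unitary irreducible lowest weight representation on which every element of $sl(\infty)=[gl(\infty),gl(\infty)]$ acts as the zero operator.
   Context: Fix positive integers $\Lambda,\Lambda_F$. A sequence $\dot I=i_1\cdots i_a$ is a finite, possibly empty, sequence of integers in $\{1,\dots,\Lambda\}$; $\#(\dot I)=a$ is its length, $\emptyset$ is the empty sequence, juxtaposition denotes concatenation, and $\delta^{\dot I}_{\dot J}$ is $1$ if $\dot I=\dot J$ and $0$ otherwise (similarly for integers). Let $\mathcal{T}_o$ be the complex vector space with basis the symbols $\bar\phi^{\lambda_1}\otimes s^{\dot K}\otimes\phi^{\lambda_2}$, $1\le\lambda_1,\lambda_2\le\Lambda_F$, $\dot K$ any sequence. For all sequences $\dot I,\dot J$ and all $\lambda_i\in\{1,\dots,\Lambda_F\}$ define linear operators on $\mathcal{T}_o$ (each written as a single symbol): first kind: $\bar\Xi^{\lambda_1}_{\lambda_2}\otimes f^{\dot I}_{\dot J}\otimes\Xi^{\lambda_3}_{\lambda_4}(\bar\phi^{\lambda_5}\otimes s^{\dot K}\otimes\phi^{\lambda_6})=\delta^{\lambda_5}_{\lambda_2}\delta^{\dot K}_{\dot J}\delta^{\lambda_6}_{\lambda_4}\,\bar\phi^{\lambda_1}\otimes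 s^{\dot I}\otimes\phi^{\lambda_3}$; second kind: $\bar\Xi^{\lambda_1}_{\lambda_2}\otimes l^{\dot I}_{\dot J}(\bar\phi^{\lambda_3}\otimes s^{\dot K}\otimes\phi^{\lambda_4})=\delta^{\lambda_3}_{\lambda_2}\sum_{\dot K_1\dot K_2=\dot K}\delta^{\dot K_1}_{\dot J}\,\bar\phi^{\lambda_1}\otimes s^{\dot I\dot K_2}\otimes\phi^{\lambda_4}$; third kind: $r^{\dot I}_{\dot J}\otimes\Xi^{\lambda_1}_{\lambda_2}(\bar\phi^{\lambda_3}\otimes s^{\dot K}\otimes\phi^{\lambda_4})=\delta^{\lambda_4}_{\lambda_2}\sum_{\dot K_1\dot K_2=\dot K}\delta^{\dot K_2}_{\dot J}\,\bar\phi^{\lambda_3}\otimes s^{\dot K_1\dot I}\otimes\phi^{\lambda_1}$; fourth kind: $\sigma^{\dot I}_{\dot J}(\bar\phi^{\lambda_1}\otimes s^{\dot K}\otimes\phi^{\lambda_2})=\sum_{\dot K_1\dot K_2\dot K_3=\dot K}\delta^{\dot K_2}_{\dot J}\,\bar\phi^{\lambda_1}\otimes s^{\dot K_1\dot I\dot K_3}\otimes\phi^{\lambda_2}$; sums run over all ways to write $\dot K$ as a concatenation of possibly empty sequences. The open string algebra $\hat{G}_{\Lambda,\Lambda_F}$ is the complex Lie algebra (commutator bracket) of operators on $\mathcal{T}_o$ spanned by all operators of these four kinds. Let $gl(\infty)$ be the span of the first-kind operators. Ordering: for finite sequences of positive integers $a=a_1\cdots a_m$, $b=b_1\cdots b_n$,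 $a>b$ means $m>n$, or $m=n\ne0$ and $a_r>b_r$ at the first index $r$ where they differ; it is applied to concatenations such as $\dot I\lambda_1\lambda_3$. Let $G^{00}$ be the span of all $\bar\Xi^{\lambda_1}_{\lambda_1}\otimes f^{\dot I}_{\dot I}\otimes\Xi^{\lambda_2}_{\lambda_2}$, $\bar\Xi^{\lambda}_{\lambda}\otimes l^{\dot I}_{\dot I}$, $r^{\dot I}_{\dot I}\otimes\Xi^{\lambda}_{\lambda}$, $\sigma^{\dot I}_{\dot I}$. Let $G^-$ be the span of all operators of the four kinds with $\#(\dot I)<\#(\dot J)$, together with those with $\#(\dot I)=\#(\dot J)$ and $\dot J\lambda_2\lambda_4>\dot I\lambda_1\lambda_3$ (first kind), $\dot J\lambda_2>\dot I\lambda_1$ (second and third kind), $\dot J>\dot I$ (fourth kind); $G^+$ is defined with all inequalities reversed. Then $\hat{G}_{\Lambda,\Lambda_F}=G^+\oplus G^{00}\oplus G^-$. Let $\omega$ be the antilinear anti-involution with $\omega(\bar\Xi^{\lambda_1}_{\lambda_2}\otimes f^{\dot I}_{\dot J}\otimes\Xi^{\lambda_3}_{\lambda_4})=\bar\Xi^{\lambda_2}_{\lambda_1}\otimes f^{\dot J}_{\dot I}\otimes\Xi^{\lambda_4}_{\lambda_3}$, $\omega(\bar\Xi^{\lambda_1}_{\lambda_2}\otimes l^{\dot I}_{\dot J})=\bar\Xi^{\lambda_2}_{\lambda_1}\otimes l^{\dot J}_{\dot I}$, $\omega(r^{\dot I}_{\dot J}\otimes\Xi^{\lambda_1}_{\lambda_2})=r^{\dot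 J}_{\dot I}\otimes\Xi^{\lambda_2}_{\lambda_1}$, $\omega(\sigma^{\dot I}_{\dot J})=\sigma^{\dot J}_{\dot I}$, extended to the universal enveloping algebra as antilinear anti-automorphism. A lowest weight $h$ is a linear functional on $G^{00}$ real on the spanning operators; write $h_I(\lambda_1;\dot I;\lambda_2)$, $h_{II}(\lambda;\dot I)$, $h_{III}(\dot I;\lambda)$, $h_{IV}(\dot I)$ for its values on $\bar\Xi^{\lambda_1}_{\lambda_1}\otimes f^{\dot I}_{\dot I}\otimes\Xi^{\lambda_2}_{\lambda_2}$, $\bar\Xi^{\lambda}_{\lambda}\otimes l^{\dot I}_{\dot I}$, $r^{\dot I}_{\dot I}\otimes\Xi^{\lambda}_{\lambda}$, $\sigma^{\dot I}_{\dot I}$. A lowest weight representation with lowest weight $h$ is a representation generated by a vector $v\ne0$ with $G^-v=0$ and $Hv=h(H)v$ for $H\in G^{00}$; it is unitary if it carries a positive definite Hermitian form with $\langle Xu,w\rangle=\langle u,\omega(X)w\rangle$ for all $X$. $h$ is approximately finite if: (i) $h_I(\lambda_1;\dot I;\lambda_2)-h_I(\lambda_3;\dot J;\lambda_4)$ is a non-negative integer whenever $\dot J\lambda_3\lambda_4>\dot I\lambda_1\lambda_2$; (ii) $h_{II}(\lambda;\dot I)=\sum_{\dot I_1,\lambda_1}h_I(\lambda;\dot I\dot I_1;\lambda_1)$; (iii) $h_{III}(\dot I;\lambda)=\sum_{\lambda_1,\dot I_1}h_I(\lambda_1;\dot I_1\dot I;\lambda)$; (iv) $h_{IV}(\dot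 I)=\sum_{\lambda_1,\dot I_1,\dot I_2,\lambda_2}h_I(\lambda_1;\dot I_1\dot I\dot I_2;\lambda_2)$; sums over all (possibly empty) sequences and all $\lambda_i\in\{1,\dots,\Lambda_F\}$, each having only finitely many non-zero terms. *)

(* Defs.v *)
(* MathComp 2.5 + real_closed (complex numbers R[i]) +
   MathComp-Analysis reals (realType).  The complex numbers are R[i] for an
   arbitrary R : realType (any such R is a model of the real numbers). *)
From HB Require Import structures.
From mathcomp Require Import all_boot all_order all_algebra.
From mathcomp Require Import complex.
From mathcomp Require Import reals.
Set Implicit Arguments.
Unset Strict Implicit.
Unset Printing Implicit Defensive.
Import Order.TTheory GRing.Theory Num.Theory.
Local Open Scope ring_scope.

(* Index conventions.  A "sequence" \dot I (entries in {1,...,L}) is a       *)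
(* seq 'I_L, the ordinal i standing for the integer i+1.  An index lambda in *)
(* {1,...,LF} is an ordinal of 'I_LF, again i standing for i+1.             *)

(* The generators (spanning operators) of the open string algebra.
   GI l1 l2 I0 J0 l3 l4  = \bar\Xi^{l1}_{l2} (x) f^I_J (x) \Xi^{l3}_{l4}
   GII l1 l2 I0 J0       = \bar\Xi^{l1}_{l2} (x) l^I_J
   GIII I0 J0 l1 l2      = r^I_J (x) \Xi^{l1}_{l2}
   GIV I0 J0             = \sigma^I_J                                        *)
Inductive gen (L LF : nat) : Type :=
| GI   of 'I_LF & 'I_LF & seq 'I_L & seq 'I_L & 'I_LF & 'I_LF
| GII  of 'I_LF & 'I_LF & seq 'I_L & seq 'I_L
| GIII of seq 'I_L & seq 'I_L & 'I_LF & 'I_LF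
| GIV  of seq 'I_L & seq 'I_L.
Arguments GI {L LF}. Arguments GII {L LF}. Arguments GIII {L LF}. Arguments GIV {L LF}.

(* basis vectors \bar\phi^{l1} (x) s^K (x) \phi^{l2} of T_o *)
Definition basis (L LF : nat) := ('I_LF * seq 'I_L * 'I_LF)%type.

(* all decompositions K = K1 K2, resp. K = K1 K2 K3 (indexed by cut points) *)
Definition cuts2 (n : nat) : seq nat := iota 0 n.+1.
Definition cuts3 (n : nat) : seq (nat * nat) :=
  [seq p <- [seq (a, b) | a <- iota 0 n.+1, b <- iota 0 n.+1] | (p.1 <= p.2)%N].

(* action of a generator on a basis vector: the image is the sum (with
   multiplicity) of the basis vectors in the returned list *)
Definition gact (L LF : nat) (g : gen L LF) (e : basis L LF) : seq (basis L LF) :=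
  let: (l5, K, l6) := e in
  match g with
  | GI l1 l2 I0 J0 l3 l4 =>
      if [&& l5 == l2, K == J0 & l6 == l4] then [:: (l1, I0, l3)] else [::]
  | GII l1 l2 I0 J0 =>
      if l5 == l2 then
        [seq (l1, I0 ++ drop n K, l6) | n <- cuts2 (size K) & take n K == J0]
      else [::]
  | GIII I0 J0 l1 l2 =>
      if l6 == l2 then
        [seq (l5, take n K ++ I0, l1) | n <- cuts2 (size K) & drop n K == J0]
      else [::]
  | GIV I0 J0 =>
      [seq (l5, take nm.1 K ++ I0 ++ drop nm.2 K, l6)
      | nm <- cuts3 (size K) & take (nm.2 - nm.1) (drop nm.1 K) == J0]
  end.

Section OpenString.
Variables (R : realType) (L LF : nat).
Local Notation C := R[i].
Local Notation gen := (gen L LF).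
Local Notation basis := (basis L LF).

(* formal finite linear combinations of generators, resp. of basis vectors *)
Definition comb := seq (C * gen).
Definition vect := seq (C * basis).

(* coefficient of a basis vector in a vector of T_o *)
Definition coef (v : vect) (b : basis) : C :=
  \sum_(p <- v) (if p.2 == b then p.1 else 0).

(* the operator on T_o denoted by a combination, applied to a basis vector *)
Definition opimg (a : comb) (e : basis) : vect :=
  flatten [seq [seq (p.1, b) | b <- gact p.2 e] | p <- a].

(* ... applied to a vector *)
Definition opapp (a : comb) (v : vect) : vect :=
  flatten [seq [seq (p.1 * q.1, q.2) | q <- opimg a p.2] | p <- v].

(* [op a, op b] = op c as operators on T_o *)
Definition op_bracket_eq (a b c : comb) : Prop :=
  forall e e' : basis,
    coef (opapp a (opimg b e)) e' - coef (opapp b (opimg a e)) e'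
    = coef (opimg c e) e'.

(* ordering on finite sequences of positive integers *)
Fixpoint lexgt (a b : seq nat) : bool :=
  match a, b with
  | x :: a', y :: b' => (y < x)%N || ((x == y) && lexgt a' b')
  | _, _ => false
  end.
Definition seqgt (a b : seq nat) : bool :=
  (size b < size a)%N || [&& size a == size b, size a != 0%N & lexgt a b].

Definition nat_of_seq (I0 : seq 'I_L) : seq nat := [seq (val i).+1 | i <- I0].
Definition nlam (l : 'I_LF) : nat := (val l).+1.

(* generators spanning G^- *)
Definition negative (g : gen) : bool :=
  match g with
  | GI l1 l2 I0 J0 l3 l4 => (size I0 < size J0)%N || ((size I0 == size J0) &&
      seqgt (nat_of_seq J0 ++ [:: nlam l2; nlam l4]) (nat_of_seq I0 ++ [:: nlam l1; nlam l3]))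
  | GII l1 l2 I0 J0 => (size I0 < size J0)%N || ((size I0 == size J0) &&
      seqgt (nat_of_seq J0 ++ [:: nlam l2]) (nat_of_seq I0 ++ [:: nlam l1]))
  | GIII I0 J0 l1 l2 => (size I0 < size J0)%N || ((size I0 == size J0) &&
      seqgt (nat_of_seq J0 ++ [:: nlam l2]) (nat_of_seq I0 ++ [:: nlam l1]))
  | GIV I0 J0 => (size I0 < size J0)%N || ((size I0 == size J0) &&
      seqgt (nat_of_seq J0) (nat_of_seq I0))
  end.

(* generators spanning G^00 *)
Definition diagonal (g : gen) : bool :=
  match g with
  | GI l1 l2 I0 J0 l3 l4 => [&& l1 == l2, I0 == J0 & l3 == l4]
  | GII l1 l2 I0 J0 => (l1 == l2) && (I0 == J0)
  | GIII I0 J0 l1 l2 => (I0 == J0) && (l1 == l2)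
  | GIV I0 J0 => I0 == J0
  end.

(* generators of gl(infinity) *)
Definition first_kind (g : gen) : bool := if g is GI _ _ _ _ _ _ then true else false.

(* the anti-involution omega on generators *)
Definition omega (g : gen) : gen :=
  match g with
  | GI l1 l2 I0 J0 l3 l4 => GI l2 l1 J0 I0 l4 l3
  | GII l1 l2 I0 J0 => GII l2 l1 J0 I0
  | GIII I0 J0 l1 l2 => GIII J0 I0 l2 l1
  | GIV I0 J0 => GIV J0 I0
  end.

(* Representations.  A representation of the open string algebra on a      *)
(* complex vector space V is given by the operators rho g (g a generator),  *)
(* extended linearly to combinations; it must be linear in V and preserve   *)
(* brackets: whenever [op a, op b] = op c in End(T_o), the same relation    *)
(* holds for the images.  (Taking a = b = 0, this also says that the        *)
(* extension is well defined on the operator algebra.)                      *)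
Definition islinear (U W : lmodType C) (f : U -> W) : Prop :=
  forall (k : C) (u v : U), f (k *: u + v) = k *: f u + f v.

Definition rhoC (V : lmodType C) (rho : gen -> V -> V) (a : comb) (x : V) : V :=
  \sum_(p <- a) p.1 *: rho p.2 x.

Definition is_rep (V : lmodType C) (rho : gen -> V -> V) : Prop :=
  (forall g, islinear (rho g)) /\
  (forall a b c : comb, op_bracket_eq a b c ->
     forall x : V, rhoC rho a (rhoC rho b x) - rhoC rho b (rhoC rho a x) = rhoC rho c x).

(* invariant subspaces *)
Definition subspace (V : lmodType C) (S : V -> Prop) : Prop :=
  S 0 /\ (forall (k : C) (u v : V), S u -> S v -> S (k *: u + v)).
Definition invariant (V : lmodType C) (rho : gen -> V -> V) (S : V -> Prop) : Prop :=
  subspace S /\ forall g u, S u -> S (rho g u).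

Definition irreducible (V : lmodType C) (rho : gen -> V -> V) : Prop :=
  (exists x : V, x != 0) /\
  forall S : V -> Prop, invariant rho S -> (forall x, S x -> x = 0) \/ (forall x, S x).

(* v generates V under the action *)
Definition generates (V : lmodType C) (rho : gen -> V -> V) (v : V) : Prop :=
  forall S : V -> Prop, invariant rho S -> S v -> forall x, S x.

(* lowest weight: a real valued function on the spanning operators of G^00
   (only its values on diagonal generators matter) *)
Definition lowest_weight_vector (V : lmodType C) (rho : gen -> V -> V)
    (h : gen -> R) (v : V) : Prop :=
  v != 0 /\ (forall g, negative g -> rho g v = 0) /\
  (forall g, diagonal g -> rho g v = ((h g)%:C)%C *: v).

Definition lowest_weight_rep_with (V : lmodType C) (rho : gen -> V -> V)
    (h : gen -> R) : Prop :=
  exists v : V, lowest_weight_vector rho h v /\ generates rho v.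

Definition lowest_weight_rep (V : lmodType C) (rho : gen -> V -> V) : Prop :=
  exists h, lowest_weight_rep_with rho h.

(* unitarity: a positive definite Hermitian form (linear in the first,
   antilinear in the second argument) for which rho g and rho (omega g) are
   adjoint (this is the condition for all X, by sesquilinearity and the
   antilinear extension of omega). *)
Definition unitary (V : lmodType C) (rho : gen -> V -> V) : Prop :=
  exists form : V -> V -> C,
    (forall w : V, islinear (fun u => form u w)) /\
    (forall u w : V, form u w = ((form w u)^*)%C) /\
    (forall u : V, u != 0 -> 0 < form u u) /\
    (forall g (u w : V), form (rho g u) w = form u (rho (omega g) w)).

(* every element of sl(infinity) = [gl(infinity), gl(infinity)] acts by 0:
   for combinations a, b of first-kind generators and c with
   op c = [op a, op b], rho(c) = 0 (this then holds on the span by linearity) *)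
Definition sl_acts_trivially (V : lmodType C) (rho : gen -> V -> V) : Prop :=
  forall a b c : comb, all (fun p => first_kind p.2) a -> all (fun p => first_kind p.2) b ->
    op_bracket_eq a b c -> forall x : V, rhoC rho c x = 0.

(* finite sums: x = sum over all t of F t, only finitely many nonzero terms *)
Definition fin_sum (T : eqType) (F : T -> R) (x : R) : Prop :=
  exists s : seq T, uniq s /\ (forall t, F t != 0 -> t \in s) /\ x = \sum_(t <- s) F t.

Definition approx_finite (h : gen -> R) : Prop :=
  let hI l1 I0 l2 := h (GI l1 l1 I0 I0 l2 l2) in
  let hII l I0 := h (GII l l I0 I0) in
  let hIII I0 l := h (GIII I0 I0 l l) in
  let hIV I0 := h (GIV I0 I0) in
  (forall l1 l2 l3 l4 (I0 J0 : seq 'I_L),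
     seqgt (nat_of_seq J0 ++ [:: nlam l3; nlam l4]) (nat_of_seq I0 ++ [:: nlam l1; nlam l2]) ->
     exists n : nat, hI l1 I0 l2 - hI l3 J0 l4 = n%:R) /\
  (forall l I0, fin_sum (fun p : seq 'I_L * 'I_LF => hI l (I0 ++ p.1) p.2) (hII l I0)) /\
  (forall I0 l, fin_sum (fun p : 'I_LF * seq 'I_L => hI p.1 (p.2 ++ I0) l) (hIII I0 l)) /\
  (forall I0, fin_sum (fun p : 'I_LF * seq 'I_L * seq 'I_L * 'I_LF =>
                        hI p.1.1.1 (p.1.1.2 ++ I0 ++ p.1.2) p.2) (hIV I0)).

(* bilinear maps and the universal property of the tensor product *)
Definition bilinear (U1 U2 W : lmodType C) (f : U1 -> U2 -> W) : Prop :=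
  (forall y, islinear (fun x => f x y)) /\ (forall x, islinear (f x)).

Definition is_tensor_product (V1 V2 V : lmodType C) (beta : V1 -> V2 -> V) : Prop :=
  bilinear beta /\
  forall (W : lmodType C) (f : V1 -> V2 -> W), bilinear f ->
    (exists g : V -> W, islinear g /\ forall x y, g (beta x y) = f x y) /\
    (forall g1 g2 : V -> W, islinear g1 -> islinear g2 ->
       (forall x y, g1 (beta x y) = f x y) -> (forall x y, g2 (beta x y) = f x y) ->
       forall z, g1 z = g2 z).

(* V is isomorphic, as a representation, to V1 (x) V2 with X acting as
   X (x) 1 + 1 (x) X *)
Definition tensor_rep_iso (V1 V2 V : lmodType C) (rho1 : gen -> V1 -> V1)
    (rho2 : gen -> V2 -> V2) (rho : gen -> V -> V) (beta : V1 -> V2 -> V) : Prop :=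
  is_tensor_product beta /\
  forall g x y, rho g (beta x y) = beta (rho1 g x) y + beta x (rho2 g y).

End OpenString.

(* Main.v *)
(** Write [E_ab] for the matrix units of gl(infinity) (the first-kind
    operators), [a] and [b] running over the basis of [T_o], well ordered by
    length and then lexicographically.  The sl(2)-triples of [E_ab] and [E_ba]
    and unitarity make the weights [h_a = h(E_aa)] decrease by integers, and
    Bessel's inequality for the second-kind operator [l^i_{}] applied to the
    lowest weight vector [v] bounds the total decrease; so [h_a = c] for all
    but finitely many [a].

    The twisted units [E'_ab = E_ab - c delta_ab] still satisfy the relations
    of gl(infinity), and on each vector of [V] they vanish for all but
    finitely many [b].  Hence [rho1 X = sum_ab X_ab E'_ab] makes sense for
    every [X] in the open string algebra.  It is a representation, and
    [rho2 = rho - rho1] is a representation commuting with it, in which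
    [E_ab] acts by [c delta_ab].  Let [V1] and [V2] be the cyclic spaces of
    [v] under [rho1] and [rho2].  Every element of [V2] is again a lowest
    weight vector for [rho1], so by triangular decomposition
    [<P y, y'> <v, v> = <P v, v> <y, y'>] for [y, y'] in [V2] and [P] in the
    algebra generated by [rho1].  This makes [(P v, y) |-> P y] a tensor
    product [V1 (x) V2 -> V], whose image is invariant and therefore [V]. *)
Require Import Defs.
From HB Require Import structures.
From mathcomp Require Import all_boot all_order all_algebra.
From mathcomp Require Import complex.
From mathcomp Require Import reals boolp.
From mathcomp Require Import zify ring.
Set Implicit Arguments.
Unset Strict Implicit.
Unset Printing Implicit Defensive.
Import Order.TTheory GRing.Theory Num.Theory.
Local Open Scope ring_scope.


(** * Generators as matrices over the basis of [T_o] *)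

Section Generators.
Variables (L LF : nat).
Local Notation gen := (gen L LF).
Local Notation basis := (basis L LF).

(** Reindexing the first-kind generators by pairs of basis vectors puts the relations of
    gl(infinity) in their standard form. *)
Definition munit (a b : basis) : gen := GI a.1.1 b.1.1 a.1.2 b.1.2 a.2 b.2.

Lemma gact_munit (a b e : basis) :
  gact (munit a b) e = if e == b then [:: a] else [::].
Proof.
case: a b e => [[a1 a2] a3] [[b1 b2] b3] [[e1 e2] e3] /=.
by rewrite !xpair_eqE andbA.
Qed.

Lemma omega_munit (a b : basis) : omega (munit a b) = munit b a.
Proof. by []. Qed.

Lemma omegaK : involutive (@omega L LF).
Proof. by case. Qed.

Lemma mem_cuts2 (n k : nat) : (n \in cuts2 k) = (n <= k)%N.
Proof. by rewrite mem_iota add0n ltnS. Qed.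


Lemma mem_cuts3 (p : nat * nat) (k : nat) :
  (p \in cuts3 k) = (p.1 <= p.2 <= k)%N.
Proof.
case: p => a b; rewrite mem_filter [X in X && _]/= [in RHS]/=.
case: leqP => // leab; rewrite !andTb.
apply/allpairsPdep/idP => [[x [y [_ + [_ ->]]]]|lebk]; first by rewrite mem_cuts2.
by exists a, b; rewrite !mem_cuts2 (leq_trans leab lebk) lebk.
Qed.

Lemma cuts3_uniq (k : nat) : uniq (cuts3 k).
Proof. by apply/filter_uniq/allpairs_uniq; rewrite ?iota_uniq // => -[? ?] [? ?]. Qed.

Lemma gactGII_P l1 l2 I0 J0 (a b : basis) :
  a \in gact (GII l1 l2 I0 J0) b ->
  exists K l, a = (l1, I0 ++ K, l) /\ b = (l2, J0 ++ K, l).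
Proof.
case: b => [[l5 K] l6]; rewrite /gact; case: eqP => // <- /mapP[n].
rewrite mem_filter => /andP[/eqP <- _] ->.
by exists (drop n K), l6; rewrite cat_take_drop.
Qed.

Lemma gactGIII_P l1 l2 I0 J0 (a b : basis) :
  a \in gact (GIII I0 J0 l1 l2) b ->
  exists l K, a = (l, K ++ I0, l1) /\ b = (l, K ++ J0, l2).
Proof.
case: b => [[l5 K] l6]; rewrite /gact; case: eqP => // <- /mapP[n].
rewrite mem_filter => /andP[/eqP <- _] ->.
by exists l5, (take n K); rewrite cat_take_drop.
Qed.

Lemma take_cut3 (T : eqType) (K J : seq T) n m : (n <= m)%N ->
  take (m - n) (drop n K) = J -> K = take n K ++ J ++ drop m K.
Proof.
move=> lenm <-; rewrite -{1}(cat_take_drop n K); congr (_ ++ _).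
by rewrite -{1}(cat_take_drop (m - n) (drop n K)) drop_drop subnK.
Qed.

Lemma gactGIV_P I0 J0 (a b : basis) :
  a \in gact (GIV I0 J0) b ->
  exists l1 K1 K3 l2, a = (l1, K1 ++ I0 ++ K3, l2) /\ b = (l1, K1 ++ J0 ++ K3, l2).
Proof.
case: b => [[l5 K] l6]; rewrite /gact => /mapP[[n m]].
rewrite mem_filter mem_cuts3 /= => /andP[/eqP eJ /andP[lenm lemk]] ->.
by exists l5, (take n K), (drop m K), l6; rewrite -(take_cut3 lenm eJ).
Qed.

(** A block of known length fits a word at one cut position only; this counts that position, so
    matrix entries of the second and third kinds are 0 or 1. *)
Lemma count_cuts2_eq (k n : nat) (c : bool) : (c -> k <= n)%N ->
  count (fun m => (m == k) && c) (cuts2 n) = c.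
Proof.
case: c => [/(_ isT) lekn|_].
  rewrite (@eq_count _ _ (pred1 k)) => [|m]; last by rewrite /= andbT.
  by rewrite count_uniq_mem ?iota_uniq // mem_cuts2 lekn.
by rewrite (@eq_count _ _ pred0) ?count_pred0 // => m; rewrite /= andbF.
Qed.

Lemma count_gactGII l1 l2 I0 J0 l5 K l6 (e : basis) :
  count_mem e (gact (GII l1 l2 I0 J0) (l5, K, l6)) =
  [&& l5 == l2, take (size J0) K == J0 & e == (l1, I0 ++ drop (size J0) K, l6)].
Proof.
rewrite /gact; case: eqP => // _; rewrite andTb count_map count_filter.
rewrite -(@count_cuts2_eq (size J0) (size K)); last first.
  by move=> /andP[/eqP <- _]; rewrite size_take_min geq_minr.
apply: eq_in_count => n; rewrite mem_cuts2 /= => lenK.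
case: (n =P size J0) => [->|neq]; first by rewrite andbC (eq_sym e).
by apply/negP => /andP[_ /eqP eJ]; case: neq; rewrite -eJ size_takel.
Qed.

Lemma count_gactGIII l1 l2 I0 J0 l5 K l6 (e : basis) :
  count_mem e (gact (GIII I0 J0 l1 l2) (l5, K, l6)) =
  [&& l6 == l2, size J0 <= size K, drop (size K - size J0) K == J0
    & e == (l5, take (size K - size J0) K ++ I0, l1)]%N.
Proof.
rewrite /gact; case: eqP => // _; rewrite andTb count_map count_filter.
rewrite -(@count_cuts2_eq (size K - size J0) (size K)); last by rewrite leq_subr.
apply: eq_in_count => n; rewrite mem_cuts2 /= => lenK.
case: (n =P (size K - size J0)%N) => [->|neq].
  rewrite andbC (eq_sym e); case: (leqP (size J0)) => //= ltKJ.
  rewrite (eqnP (ltnW ltKJ)) drop0 take0; apply/negbTE/negP => /andP[/eqP eJ _].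
  by rewrite eJ ltnn in ltKJ.
by apply/negP => /andP[_ /eqP eJ]; case: neq; rewrite -eJ size_drop subKn.
Qed.

(** The first cut [n] forces the second to be [n + size J0]. The range [M] is left free so that
    words of different lengths can be counted over the same positions. *)
Lemma count_gactGIV I0 J0 l5 K l6 (e : basis) M : (size K < M)%N ->
  count_mem e (gact (GIV I0 J0) (l5, K, l6)) =
  count (fun n => [&& n + size J0 <= size K, take (size J0) (drop n K) == J0
    & e == (l5, take n K ++ I0 ++ drop (n + size J0) K, l6)]%N) (iota 0 M).
Proof.
move=> ltKM; rewrite /gact count_map count_filter count_filter count_flatten -map_comp.
rewrite -(subnKC ltKM) iotaD count_cat [X in _ = (_ + X)%N](_ : _ = 0%N); last first.
  apply/eqP; rewrite -leqn0 leqNgt -has_count; apply/hasPn => n.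
  by rewrite mem_iota add0n => /andP[lt _]; apply/negP => /and3P[]; lia.
rewrite addn0 -sumn_count; congr sumn; apply/eq_in_map => n.
rewrite -/(cuts2 _) mem_cuts2 => lenK; rewrite [LHS]count_map.
rewrite -[RHS](@count_cuts2_eq (n + size J0) (size K)); last by case/and3P.
apply: eq_in_count => m; rewrite mem_cuts2 /= => lemK.
case: (m =P (n + size J0)%N) => [em|neq].
  by move: lemK; rewrite em addKn leq_addr andbT andbC (eq_sym e) => ->.
apply/negP => /andP[/andP[_ /eqP eJ] lenm]; case: neq.
by rewrite -eJ size_takel ?size_drop ?subnKC // leq_sub2r.
Qed.

(* The matrix of [omega g] is the transpose of the matrix of [g]. *)
Lemma count_gact_omega (g : gen) (e e' : basis) :
  count_mem e' (gact g e) = count_mem e (gact (omega g) e').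
Proof.
case: e e' => [[a1 K] a3] [[b1 K'] b3].
case: g => [l1 l2 I0 J0 l3 l4|l1 l2 I0 J0|I0 J0 l1 l2|I0 J0].
- rewrite -[GI _ _ _ _ _ _]/(munit (l1, I0, l3) (l2, J0, l4)) omega_munit !gact_munit.
  by rewrite !(fun_if (count_mem _)) /= !addn0 (eq_sym _ (b1, K', b3)) (eq_sym (l2, J0, l4));
    do 2!case: eqP.
- rewrite [omega _]/= !count_gactGII; congr nat_of_bool.
  by apply/and3P/and3P => -[/eqP-> /eqP eJ /eqP[-> -> ->]];
    rewrite take_size_cat // drop_size_cat // -{1}eJ cat_take_drop.
- rewrite [omega _]/= !count_gactGIII; congr nat_of_bool.
  by apply/and4P/and4P => -[/eqP-> le /eqP eJ /eqP[-> -> ->]];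
    rewrite size_cat addnK drop_size_cat ?take_size_cat // leq_addl // -{2}eJ cat_take_drop.
- pose M := (maxn (size K) (size K')).+1.
  rewrite [omega _]/= !(@count_gactGIV _ _ _ _ _ _ M) ?ltnS ?leq_maxl ?leq_maxr //.
  (* Replacing a block at position [n] is undone by the reverse replacement at the same [n], so the
     two counts agree position by position. *)
  have sym x y (J I : seq 'I_L) x1 x3 y1 y3 n :
      [&& n + size J <= size x, take (size J) (drop n x) == J
      & (y1, y, y3) == (x1, take n x ++ I ++ drop (n + size J) x, x3) :> basis]%N ->
      [&& n + size I <= size y, take (size I) (drop n y) == I
      & (x1, x, x3) == (y1, take n y ++ J ++ drop (n + size I) y, y3) :> basis]%N.
    case/and3P => le /eqP eJ /eqP[-> -> ->].
    have sz : size (take n x) = n by rewrite size_takel //; lia.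
    have ex : x = take n x ++ J ++ drop (n + size J) x.
      by apply: take_cut3; rewrite ?leq_addr // addKn.
    move: (take n x) (drop _ x) sz ex => A B <- ->.
    by rewrite !size_cat leq_add2l leq_addr drop_size_cat // !take_size_cat //
      [A ++ I ++ _]catA drop_size_cat ?size_cat // !eqxx.
  by apply: eq_count => n; apply/idP/idP; apply: sym.
Qed.

Definition deg (b : basis) : nat := size b.1.2.

Definition gen_shift (g : gen) : nat :=
  match g with
  | GI _ _ I0 _ _ _ | GII _ _ I0 _ | GIII I0 _ _ _ | GIV I0 _ => size I0
  end.

Lemma deg_gact (g : gen) (a b : basis) :
  a \in gact g b -> (deg a <= deg b + gen_shift g)%N.
Proof.
case: g => [l1 l2 I0 J0 l3 l4|l1 l2 I0 J0|I0 J0 l1 l2|I0 J0].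
- rewrite -[GI _ _ _ _ _ _]/(munit (l1, I0, l3) (l2, J0, l4)) gact_munit.
  by case: ifP => // _; rewrite inE => /eqP ->; exact: leq_addl.
- by case/gactGII_P => K [l [-> ->]]; rewrite /deg /= !size_cat; lia.
- by case/gactGIII_P => l [K [-> ->]]; rewrite /deg /= !size_cat; lia.
- by case/gactGIV_P => l [K [K3 [l3 [-> ->]]]]; rewrite /deg /= !size_cat; lia.
Qed.

(** Finite because both index sets are. These sets truncate sums over the infinite basis. *)
Definition ball (n : nat) : seq basis :=
  undup (flatten [seq [seq (l.1, tval t, l.2) |
    l <- enum {: 'I_LF * 'I_LF}, t <- enum {: k.-tuple 'I_L}] | k <- iota 0 n]).

Lemma ball_uniq (n : nat) : uniq (ball n).
Proof. exact: undup_uniq. Qed.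

Lemma mem_ball (n : nat) (b : basis) : (b \in ball n) = (deg b < n)%N.
Proof.
rewrite mem_undup; apply/flattenP/idP => [[_ /mapP[k + ->]]|ltn].
  rewrite mem_iota => /andP[_ ltkn] /allpairsPdep[l [t [_ _ ->]]].
  by rewrite /deg size_tuple.
exists [seq (l.1, tval t, l.2) |
    l <- enum {: 'I_LF * 'I_LF}, t <- enum {: (deg b).-tuple 'I_L}].
  by apply: map_f; rewrite mem_iota.
apply/allpairsPdep; exists (b.1.1, b.2), (in_tuple b.1.2).
by rewrite !mem_enum; split => //; case: b {ltn} => [[? ?] ?].
Qed.

(** * The order on basis vectors *)

Lemma lexgt_cat (s t u w : seq nat) : size s = size t ->
  lexgt (s ++ u) (t ++ w) = lexgt s t || (s == t) && lexgt u w.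
Proof.
elim: s t => [|x s IH] [|y t] //= [/IH ->].
by rewrite eqseq_cons andb_orr orbA andbA.
Qed.

Lemma lexgt_total (s t : seq nat) : size s = size t ->
  [|| s == t, lexgt s t | lexgt t s].
Proof.
elim: s t => [|x s IH] [|y t] //= [/IH].
by rewrite eqseq_cons; case: (ltngtP x y) => //= _.
Qed.

Definition code (b : basis) : seq nat :=
  nat_of_seq b.1.2 ++ [:: nlam b.1.1; nlam b.2].

Lemma nat_of_seq_inj : injective (@nat_of_seq L).
Proof. by apply: inj_map => i j [/val_inj]. Qed.

Lemma code_inj : injective code.
Proof.
move=> [[a1 a2] a3] [[b1 b2] b3] e; have := congr1 size e.
rewrite /code !size_cat !size_map /= => /addIn sz; move/eqP: e.
rewrite eqseq_cat ?size_map //= => /and3P[/eqP/nat_of_seq_inj -> /eqP[/val_inj ->]].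
by case/andP => /eqP[/val_inj ->].
Qed.

(* The order on basis vectors for which the elements of G^- are strictly upper
   triangular, see [gact_negative]. *)
Definition bless (a b : basis) : bool := negative (munit a b).

Lemma seqgt_cat (s t u w : seq nat) : size u = size w -> (0 < size u)%N ->
  seqgt (s ++ u) (t ++ w) =
  (size t < size s)%N || (size s == size t) && lexgt (s ++ u) (t ++ w).
Proof.
move=> euw u0; rewrite /seqgt !size_cat euw ltn_add2r eqn_add2r addn_eq0.
by rewrite -euw -[size u == _]negbK -lt0n u0 andbF.
Qed.

Lemma blessE (a b : basis) : bless a b =
  (deg a < deg b)%N || (deg a == deg b) && lexgt (code b) (code a).
Proof.
rewrite /bless /= -/(code a) -/(code b) seqgt_cat //= !size_map.
by rewrite -/(deg a) -/(deg b); case: ltngtP.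
Qed.

Lemma bless_total (a b : basis) : [|| a == b, bless a b | bless b a].
Proof.
rewrite !blessE; case: ltngtP; rewrite ?orbT //= => e.
have := @lexgt_total (code a) (code b).
rewrite !size_cat !size_map /= -/(deg a) -/(deg b) e => /(_ erefl).
by rewrite (inj_eq code_inj) (orbC (lexgt (code b) _)).
Qed.

Lemma bless_deg (a b : basis) : bless a b -> (deg a <= deg b)%N.
Proof. by rewrite blessE; case: ltngtP. Qed.

Lemma bless_ltdeg (a b : basis) : (deg a < deg b)%N -> bless a b.
Proof. by rewrite blessE => ->. Qed.

Lemma bless_irr (a : basis) : bless a a = false.
Proof.
rewrite blessE ltnn eqxx /=; elim: (code a) => //= x s ->.
by rewrite ltnn andbF.
Qed.

Lemma bless_neq (a b : basis) : bless a b -> (a == b) = false.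
Proof. by apply: contraTF => /eqP ->; rewrite bless_irr. Qed.

Lemma diagonal_munit (b : basis) : diagonal (munit b b).
Proof. by rewrite /= !eqxx. Qed.

Lemma gact_diagonal (g : gen) (a b : basis) : diagonal g -> a \in gact g b -> a = b.
Proof.
case: g => [l1 l2 I0 J0 l3 l4|l1 l2 I0 J0|I0 J0 l1 l2|I0 J0].
- rewrite -[GI _ _ _ _ _ _]/(munit (l1, I0, l3) (l2, J0, l4)) gact_munit.
  case: eqP => [->|//]; rewrite inE => + /eqP -> /=.
  by case/and3P => /= /eqP -> /eqP -> /eqP ->.
- by case/andP => /eqP -> /eqP -> /gactGII_P[K [l [-> ->]]].
- by case/andP => /eqP -> /eqP -> /gactGIII_P[K [l [-> ->]]].
- by move/eqP => -> /gactGIV_P[l [K [K3 [l3 [-> ->]]]]].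
Qed.

(** The words of [a] and [b] differ in one block only. Their common prefix and suffix leave the
    comparison to the blocks and the end indices. *)
Lemma gact_negative (g : gen) (a b : basis) :
  negative g -> a \in gact g b -> bless a b.
Proof.
have cat_nat (s t : seq 'I_L) : nat_of_seq (s ++ t) = nat_of_seq s ++ nat_of_seq t.
  exact: map_cat.
have lexl (s t u w : seq nat) : size s = size t -> lexgt s t -> lexgt (s ++ u) (t ++ w).
  by move=> e lt; rewrite lexgt_cat // lt.
have lexr (s u w : seq nat) : lexgt u w -> lexgt (s ++ u) (s ++ w).
  by move=> lt; rewrite lexgt_cat // eqxx lt orbT.
have sz_nat (s : seq 'I_L) : size (nat_of_seq s) = size s by exact: size_map.
case: g => [l1 l2 I0 J0 l3 l4|l1 l2 I0 J0|I0 J0 l1 l2|I0 J0].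
- rewrite -[GI _ _ _ _ _ _]/(munit (l1, I0, l3) (l2, J0, l4)) gact_munit => neg.
  by case: eqP => [->|//]; rewrite inE => /eqP ->.
- move=> neg /gactGII_P[K [l [-> ->]]]; rewrite blessE /deg /code /= !size_cat.
  rewrite ltn_add2r eqn_add2r.
  case/orP: neg => [->//|/andP[/eqP e]]; rewrite seqgt_cat // !sz_nat e ltnn eqxx /=.
  rewrite !cat_nat -!catA !lexgt_cat ?sz_nat //= !andbF !orbF.
  by case/orP => [->//|/andP[/eqP -> ->]]; rewrite !eqxx ?andbT ?orbT.
- move=> neg /gactGIII_P[l [K [-> ->]]]; rewrite blessE /deg /code /= !size_cat.
  rewrite ltn_add2l eqn_add2l.
  case/orP: neg => [->//|/andP[/eqP e]]; rewrite seqgt_cat // !sz_nat e ltnn eqxx /=.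
  rewrite !cat_nat -!catA !lexgt_cat ?sz_nat //= !andbF !orbF !eqxx /= ltnn /=.
  by case/orP => [->|/andP[/eqP -> ->]]; rewrite ?eqxx ?orbT.
- move=> neg /gactGIV_P[l [K [K3 [l3 [-> ->]]]]]; rewrite blessE /deg /code /= !size_cat.
  rewrite ltn_add2l eqn_add2l ltn_add2r eqn_add2r.
  case/orP: neg => [->//|/andP[/eqP e]]; rewrite /seqgt !sz_nat e ltnn eqxx /=.
  by case/andP => _ lt; rewrite !cat_nat -!catA; apply/lexr/lexl; rewrite ?sz_nat.
Qed.

End Generators.


(** * Subspaces, forms and operator algebras *)

Section Subspaces.
Variables (R : realType) (V : lmodType R[i]).

(** Excluded middle makes the [Prop]-valued subspace boolean, so that subtyping turns it into a
    module; [hS] is an argument so that closure can be inferred from the predicate. *)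
Definition subspace_pred (S : V -> Prop) (hS : subspace S) : {pred V} :=
  fun x => `[< S x >].

Section Sub.
Variables (S : V -> Prop) (hS : subspace S).

Fact subspace_pred_closed : submod_closed (subspace_pred hS).
Proof.
case: hS => S0 Slin; split; first exact/asboolP.
by move=> k u v /asboolP Su /asboolP Sv; apply/asboolP/Slin.
Qed.

HB.instance Definition _ :=
  GRing.isSubmodClosed.Build R[i] V (subspace_pred hS) subspace_pred_closed.

Record subspace_of : predArgType :=
  SubspaceOf { subspace_val : V; _ : subspace_val \in subspace_pred hS }.

HB.instance Definition _ := [isSub for subspace_val].
HB.instance Definition _ := [Choice of subspace_of by <:].
HB.instance Definition _ := [SubChoice_isSubLmodule of subspace_of by <:].

Lemma subspace_valP (x : subspace_of) : S (val x).
Proof. by case: x => y Sy; exact/asboolP. Qed.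

Definition in_subspace (x : V) (Sx : S x) : subspace_of :=
  SubspaceOf (introT (asboolP (S x)) Sx : x \in subspace_pred hS).

Lemma subspace_val_islinear : islinear (val : subspace_of -> V).
Proof. by move=> k x y; rewrite linearP. Qed.
End Sub.

End Subspaces.

Section Linear.
Variables (R : realType) (U W : lmodType R[i]) (f : U -> W).
Hypothesis flin : islinear f.

Lemma islinearD x y : f (x + y) = f x + f y.
Proof. by rewrite -[x]scale1r flin !scale1r. Qed.

Lemma islinear0 : f 0 = 0.
Proof. by apply: (@addrI _ (f 0)); rewrite -islinearD !addr0. Qed.

Lemma islinearZ k x : f (k *: x) = k *: f x.
Proof. by rewrite -[k *: x]addr0 flin islinear0 addr0. Qed.

Lemma islinearN x : f (- x) = - f x.
Proof. by rewrite -scaleN1r islinearZ scaleN1r. Qed.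

Lemma islinearB x y : f (x - y) = f x - f y.
Proof. by rewrite islinearD islinearN. Qed.

Lemma islinear_sum (I : Type) (r : seq I) (P : pred I) (F : I -> U) :
  f (\sum_(i <- r | P i) F i) = \sum_(i <- r | P i) f (F i).
Proof. by elim/big_rec2: _ => [|i y x _ <-]; rewrite ?islinear0 ?islinearD. Qed.

End Linear.

Section SubspaceClosure.
Variables (R : realType) (V : lmodType R[i]) (S : V -> Prop).
Hypothesis hS : subspace S.

Lemma subspace0 : S 0. Proof. by case: hS. Qed.

Lemma subspaceD x y : S x -> S y -> S (x + y).
Proof. by move=> Sx Sy; rewrite -[x]scale1r; apply: hS.2. Qed.

Lemma subspaceZ k x : S x -> S (k *: x).
Proof. by move=> Sx; rewrite -[_ *: _]addr0; apply: hS.2 => //; exact: subspace0. Qed.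

Lemma subspaceB x y : S x -> S y -> S (x - y).
Proof. by move=> Sx Sy; apply: subspaceD => //; rewrite -scaleN1r; apply: subspaceZ. Qed.

End SubspaceClosure.

(** Separated from adjointness because one form serves [rho], [rho1] and [rho2]. The codomain
    [R[i]^o] is the scalar field as a module over itself. *)
Definition hermitian_pd (R : realType) (V : lmodType R[i]) (form : V -> V -> R[i]) :=
  (forall w, islinear (fun u => form u w : R[i]^o)) /\
  (forall u w, form u w = ((form w u)^*)%C) /\
  (forall u, u != 0 -> 0 < form u u).

Section Form.
Variables (R : realType) (V : lmodType R[i]) (form : V -> V -> R[i]).
Hypothesis hform : hermitian_pd form.

Lemma form_linl w : islinear (fun u => form u w : R[i]^o).
Proof. by case: hform. Qed.

Lemma form_conj u w : form u w = ((form w u)^*)%C.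
Proof. by case: hform => _ []. Qed.

Lemma form_gt0 u : u != 0 -> 0 < form u u.
Proof. by case: hform => _ [_]; exact. Qed.

Lemma form0l w : form 0 w = 0. Proof. exact: (islinear0 (form_linl w)). Qed.
Lemma formDl u u' w : form (u + u') w = form u w + form u' w.
Proof. exact: (islinearD (form_linl w)). Qed.
Lemma formBl u u' w : form (u - u') w = form u w - form u' w.
Proof. exact: (islinearB (form_linl w)). Qed.
Lemma formZl k u w : form (k *: u) w = k * form u w.
Proof. exact: (islinearZ (form_linl w)). Qed.
Lemma form_suml (I : Type) (r : seq I) (P : pred I) (F : I -> V) w :
  form (\sum_(i <- r | P i) F i) w = \sum_(i <- r | P i) form (F i) w.
Proof. exact: (islinear_sum (form_linl w)). Qed.

Lemma form0r w : form w 0 = 0. Proof. by rewrite form_conj form0l rmorph0. Qed.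
Lemma formDr w u u' : form w (u + u') = form w u + form w u'.
Proof. by rewrite form_conj formDl rmorphD /= -!form_conj. Qed.
Lemma formBr w u u' : form w (u - u') = form w u - form w u'.
Proof. by rewrite form_conj formBl rmorphB /= -!form_conj. Qed.
Lemma formZr k w u : form w (k *: u) = (k^*)%C * form w u.
Proof. by rewrite form_conj formZl rmorphM /= -form_conj. Qed.
Lemma form_sumr (I : Type) (r : seq I) (P : pred I) (F : I -> V) w :
  form w (\sum_(i <- r | P i) F i) = \sum_(i <- r | P i) form w (F i).
Proof. by rewrite form_conj form_suml rmorph_sum /=; apply: eq_bigr => i _; rewrite -form_conj. Qed.

Lemma form_ge0 u : 0 <= form u u.
Proof. by have [->|/form_gt0/ltW//] := eqVneq u 0; rewrite form0l. Qed.

Lemma form_eq0 u : form u u = 0 -> u = 0.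
Proof. by move=> e; apply/eqP/negP => /negP /form_gt0; rewrite e ltxx. Qed.
End Form.

Lemma unitaryP (R : realType) (L LF : nat) (V : lmodType R[i])
    (rho : gen L LF -> V -> V) :
  unitary rho <-> exists form, hermitian_pd form /\
    forall g u w, form (rho g u) w = form u (rho (omega g) w).
Proof.
by split=> -[form]; [case=> h1 [h2 [h3 h4]]|case=> -[h1 [h2 h3]] h4]; exists form.
Qed.


(** * The algebra generated by a family of operators, and its cyclic spaces *)

Section OperatorAlgebra.
Variables (R : realType) (V : lmodType R[i]) (I : Type) (E : I -> V -> V).

(** The image of the enveloping algebra in the endomorphisms of [V], given by plain functions so
    that proofs go by induction on the way an operator is built. *)
Inductive opalg : (V -> V) -> Prop :=
| opalg_id : opalg id
| opalg_gen i : opalg (E i)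
| opalg_comp P Q : opalg P -> opalg Q -> opalg (fun x => P (Q x))
| opalg_lin (k : R[i]) P Q : opalg P -> opalg Q -> opalg (fun x => k *: P x + Q x).

Definition orbit (v x : V) : Prop := exists2 P, opalg P & x = P v.

Lemma orbit_refl v : orbit v v.
Proof. by exists id => //; exact: opalg_id. Qed.

Lemma orbit_subspace v : subspace (orbit v).
Proof.
split=> [|k _ _ [P aP ->] [Q aQ ->]]; last by eexists; first exact: (opalg_lin k aP aQ).
(* The zero operator is obtained as [-1] times the identity plus the identity. *)
by eexists; [exact: (opalg_lin (-1) opalg_id opalg_id)|rewrite /= scaleN1r addNr].
Qed.

Lemma orbit_opalg P v x : opalg P -> orbit v x -> orbit v (P x).
Proof. by move=> aP [Q aQ ->]; eexists; first exact: (opalg_comp aP aQ). Qed.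

Lemma opalg_stable (S : V -> Prop) P x : subspace S ->
  (forall i y, S y -> S (E i y)) -> opalg P -> S x -> S (P x).
Proof.
move=> hS hE aP; elim: aP x => [|i|P1 P2 _ IH1 _ IH2|k P1 P2 _ IH1 _ IH2] x Sx //.
- exact: hE.
- exact/IH1/IH2.
- exact: hS.2 (IH1 _ Sx) (IH2 _ Sx).
Qed.

Hypothesis Elin : forall i, islinear (E i).

Lemma opalg_islinear P : opalg P -> islinear P.
Proof.
elim=> // [P1 P2 _ IH1 _ IH2|c P1 P2 _ IH1 _ IH2] k x y; first by rewrite IH2 IH1.
by rewrite IH1 IH2 !scalerDr !scalerA [k * c]mulrC addrACA.
Qed.

Lemma opalg_commute (D : V -> V) P : islinear D ->
  (forall i x, D (E i x) = E i (D x)) -> opalg P -> forall x, D (P x) = P (D x).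
Proof.
move=> Dlin com; elim=> // [P1 P2 _ IH1 _ IH2|k P1 P2 _ IH1 _ IH2] x.
  by rewrite IH1 IH2.
by rewrite Dlin IH1 IH2.
Qed.

Lemma opalg_adjoint (form : V -> V -> R[i]) (w : I -> I) P : hermitian_pd form ->
  (forall i x y, form (E i x) y = form x (E (w i) y)) -> opalg P ->
  exists2 Q, opalg Q & forall x y, form (P x) y = form x (Q y).
Proof.
move=> hf adj; elim=> [|i|P1 P2 _ [Q1 a1 e1] _ [Q2 a2 e2]|k P1 P2 _ [Q1 a1 e1] _ [Q2 a2 e2]].
- by exists id => //; exact: opalg_id.
- by exists (E (w i)); [exact: opalg_gen|exact: adj].
- by exists (fun x => Q2 (Q1 x)); [exact: opalg_comp|move=> x y; rewrite e1 e2].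
- exists (fun x => (k^*)%C *: Q1 x + Q2 x); first exact: opalg_lin.
  move=> x y; rewrite (formDl hf) (formZl hf) (formDr hf) (formZr hf) e1 e2.
  by rewrite conjcK.
Qed.
End OperatorAlgebra.

(** * Restriction to an invariant subspace *)

Section Restriction.
Variables (R : realType) (L LF : nat) (V : lmodType R[i]) (rho : gen L LF -> V -> V).
Variables (S : V -> Prop) (hS : subspace S).
Hypothesis Sinv : forall g x, S x -> S (rho g x).

Definition restr (g : gen L LF) (x : subspace_of hS) : subspace_of hS :=
  in_subspace hS (Sinv g (subspace_valP x)).

Lemma val_restr g x : val (restr g x) = rho g (val x).
Proof. by []. Qed.

Lemma val_rhoC_restr a x : val (rhoC restr a x) = rhoC rho a (val x).
Proof. by rewrite /rhoC linear_sum; apply: eq_bigr => p _; rewrite linearZ. Qed.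

Lemma restr_islinear g : islinear (rho g) -> islinear (restr g).
Proof. by move=> lin k x y; apply: val_inj; rewrite !linearP !val_restr linearP lin. Qed.

Lemma restr_is_rep : is_rep rho -> is_rep restr.
Proof.
case=> lin brk; split=> [g|a b c abc x]; first exact: restr_islinear.
by apply: val_inj; rewrite linearB /= !val_rhoC_restr (brk _ _ _ abc).
Qed.

Lemma restr_unitary (form : V -> V -> R[i]) : hermitian_pd form ->
  (forall g u w, form (rho g u) w = form u (rho (omega g) w)) -> unitary restr.
Proof.
move=> [h1 [h2 h3]] adj; apply/unitaryP; exists (fun x y => form (val x) (val y)).
split=> [|g u w]; last exact: adj.
split=> [w k x y|]; first by rewrite linearP h1.
split=> [u w|u u0]; first exact: h2.
by apply: h3; apply: contraNneq u0 => e; apply/eqP/val_inj; rewrite e linear0.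
Qed.

Lemma restr_lowest_weight h v (Sv : S v) :
  lowest_weight_vector rho h v -> lowest_weight_vector restr h (in_subspace hS Sv).
Proof.
move=> [v0 [neg diag]]; split; last split=> g hg.
- by apply: contraNneq v0 => e; rewrite -[v]/(val (in_subspace hS Sv)) e linear0.
- by apply: val_inj; rewrite val_restr neg // linear0.
- by apply: val_inj; rewrite val_restr diag // linearZ.
Qed.

Lemma restr_generates v (Sv : S v) :
  (forall T : V -> Prop, Defs.invariant rho T -> T v -> forall x, S x -> T x) ->
  generates restr (in_subspace hS Sv).
Proof.
move=> gen T [hT invT] Tv x.
pose T' (y : V) := exists2 z, T z & val z = y.
suff [z Tz /val_inj <-//] : T' (val x).
apply: (gen T') (subspace_valP x); last by exists (in_subspace hS Sv).
split=> [|g _ [y Ty <-]]; last by exists (restr g y); first exact: invT.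
split; first by exists 0; [exact: hT.1|exact: linear0].
move=> k _ _ [y Ty <-] [z Tz <-]; exists (k *: y + z); first exact: hT.2.
by rewrite linearP.
Qed.
End Restriction.


(** * Factorization of a cyclic space under commuting actions *)

(* By positivity, a tensor killed by all contractions in its first factor is 0. *)
Lemma bilinear_sum_eq0 (R : realType) (U1 U2 W : lmodType R[i])
    (form : U1 -> U1 -> R[i]) (f : U1 -> U2 -> W) (s : seq (U1 * U2)) :
  hermitian_pd form -> Defs.bilinear f ->
  (forall x, \sum_(p <- s) form p.1 x *: p.2 = 0) -> \sum_(p <- s) f p.1 p.2 = 0.
Proof.
move=> hf [fl fr]; have [n] := ubnP (size s).
elim: n s => // n IH [|[x0 y0] s] /=; first by rewrite big_nil.
rewrite ltnS => ltsn h0; rewrite big_cons /=.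
have h x : form x0 x *: y0 + \sum_(p <- s) form p.1 x *: p.2 = 0.
  by have := h0 x; rewrite big_cons.
have [ex0|x0n0] := eqVneq x0 0.
  rewrite ex0 in h *; rewrite (islinear0 (fl y0)) add0r; apply: IH => // x.
  by have := h x; rewrite (form0l hf) scale0r add0r.
have a0 : form x0 x0 != 0 by rewrite gt_eqF // (form_gt0 hf).
(* Contracting with [x0] expresses [y0] through the other second factors. Substitution removes the
   first term and replaces every other first factor by its component orthogonal to [x0], so the list
   gets shorter. *)
pose c (q : U1 * U2) := form q.1 x0 / form x0 x0.
have y0E : y0 = - \sum_(q <- s) c q *: q.2.
  apply: (scalerI a0); apply/eqP; rewrite scalerN -addr_eq0 -[X in _ == X](h x0); apply/eqP.
  congr (_ + _); rewrite scaler_sumr; apply: eq_bigr => q _.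
  by rewrite scalerA /c mulrC divfK.
pose t := [seq (q.1 - c q *: x0, q.2) | q <- s].
have <- : \sum_(p <- t) f p.1 p.2 = f x0 y0 + \sum_(q <- s) f q.1 q.2.
  rewrite big_map /= y0E (islinearN (fr _)) (islinear_sum (fr _)) -sumrN -big_split /=.
  apply: eq_bigr => q _; rewrite (islinearB (fl _)) (islinearZ (fl _)).
  by rewrite (islinearZ (fr _)) addrC.
apply: IH; first by rewrite size_map.
move=> x; rewrite big_map /= -[RHS](h x) y0E scalerN scaler_sumr -sumrN -big_split /=.
apply: eq_bigr => q _; rewrite (formBl hf) (formZl hf) scalerBl addrC scalerA.
by rewrite [_ * form x0 x]mulrC.
Qed.

Section Factorization.
Variables (R : realType) (L LF : nat) (V : lmodType R[i]).
Variables (rho rho1 rho2 : gen L LF -> V -> V) (form : V -> V -> R[i]) (v : V).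
Hypothesis hf : hermitian_pd form.
Hypothesis v0 : v != 0.
Hypothesis lin1 : forall g, islinear (rho1 g).
Hypothesis lin2 : forall g, islinear (rho2 g).
Hypothesis com : forall g k x, rho1 g (rho2 k x) = rho2 k (rho1 g x).
Hypothesis adj1 : forall g u w, form (rho1 g u) w = form u (rho1 (omega g) w).
Hypothesis rhoE : forall g x, rho g x = rho1 g x + rho2 g x.
Hypothesis irr : irreducible rho.
Hypothesis factor : forall P y y', opalg rho1 P -> orbit rho2 v y -> orbit rho2 v y' ->
  form (P y) y' * form v v = form (P v) v * form y y'.

Local Notation V1 := (subspace_of (orbit_subspace rho1 v)).
Local Notation V2 := (subspace_of (orbit_subspace rho2 v)).

Lemma orbit1_stable g x : orbit rho1 v x -> orbit rho1 v (rho1 g x).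
Proof. by apply: orbit_opalg; exact: opalg_gen. Qed.

Lemma orbit2_stable g x : orbit rho2 v x -> orbit rho2 v (rho2 g x).
Proof. by apply: orbit_opalg; exact: opalg_gen. Qed.

Definition factor1 : gen L LF -> V1 -> V1 := restr orbit1_stable.
Definition factor2 : gen L LF -> V2 -> V2 := restr orbit2_stable.
Definition vac1 : V1 := in_subspace _ (orbit_refl rho1 v).
Definition vac2 : V2 := in_subspace _ (orbit_refl rho2 v).

(** An arbitrary choice of an operator producing [x] from [v]; by [opalg_eq_orbit2] the value of
    [beta] does not depend on it. *)
Definition op_of (x : V1) : V -> V := projT1 (cid2 (subspace_valP x)).

Lemma op_of_opalg x : opalg rho1 (op_of x).
Proof. by rewrite /op_of; case: cid2. Qed.

Lemma op_ofE x : op_of x v = val x.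
Proof. by rewrite /op_of; case: cid2. Qed.

Definition beta (x : V1) (y : V2) : V := op_of x (val y).

(** Write [y = T v] with [T] commuting with [P] and [Q]; then [P y = T (P v) = T (Q v) = Q y]. *)
Lemma opalg_eq_orbit2 P Q y : opalg rho1 P -> opalg rho1 Q -> P v = Q v ->
  orbit rho2 v y -> P y = Q y.
Proof.
move=> aP aQ e [T aT ->].
have comT g x : T (rho1 g x) = rho1 g (T x).
  by rewrite (opalg_commute (lin1 g) (com g) aT).
have linT := opalg_islinear lin2 aT.
by rewrite -!(opalg_commute linT comT) // e.
Qed.

Lemma beta_bilinear : Defs.bilinear beta.
Proof.
split=> [y|x] k a b; last first.
  by rewrite /beta linearP /= (opalg_islinear lin1 (op_of_opalg x)).
pose P x := k *: op_of a x + op_of b x.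
rewrite -[RHS]/(P (val y)); apply: opalg_eq_orbit2; last exact: subspace_valP.
- exact: op_of_opalg.
- by apply: opalg_lin; exact: op_of_opalg.
- by rewrite /P !op_ofE linearP.
Qed.

Lemma beta_vac2 x : beta x vac2 = val x.
Proof. exact: op_ofE. Qed.

Lemma beta_vac1 y : beta vac1 y = val y.
Proof.
by apply: (opalg_eq_orbit2 (op_of_opalg _) (opalg_id _) _ (subspace_valP y)); exact: op_ofE.
Qed.

Lemma rho1_beta g x y : rho1 g (beta x y) = beta (factor1 g x) y.
Proof.
apply: (opalg_eq_orbit2 (opalg_comp (opalg_gen _ g) (op_of_opalg x))
  (op_of_opalg _) _ (subspace_valP y)).
by rewrite !op_ofE.
Qed.

Lemma rho2_beta g x y : rho2 g (beta x y) = beta x (factor2 g y).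
Proof.
by rewrite /beta (opalg_commute (lin2 g) _ (op_of_opalg x)) // => k z; rewrite com.
Qed.

Lemma rho_beta g x y : rho g (beta x y) = beta (factor1 g x) y + beta x (factor2 g y).
Proof. by rewrite rhoE rho1_beta rho2_beta. Qed.

(** Moving the operator of [x'] to the left by adjunction leaves one operator of the [rho1] algebra,
    to which [factor] applies. *)
Lemma form_beta x y x' y' :
  form (beta x y) (beta x' y') * form v v = form (val x) (val x') * form (val y) (val y').
Proof.
have [Q aQ adjQ] := opalg_adjoint hf adj1 (op_of_opalg x').
have adjQ' u w : form u (op_of x' w) = form (Q u) w.
  by rewrite (form_conj hf) adjQ -(form_conj hf).
rewrite /beta adjQ' -(op_ofE x) -[val x']op_ofE adjQ'.
exact: (factor (opalg_comp aQ (op_of_opalg x)) (subspace_valP y) (subspace_valP y')).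
Qed.

(** The span as an intersection of subspaces: a property is proved on it by taking the property
    itself as [T]. *)
Definition beta_span (S1 : V1 -> Prop) (S2 : V2 -> Prop) (z : V) : Prop :=
  forall T : V -> Prop, subspace T ->
    (forall x y, S1 x -> S2 y -> T (beta x y)) -> T z.

Lemma beta_span_invariant S1 S2 : Defs.invariant factor1 S1 ->
  Defs.invariant factor2 S2 -> Defs.invariant rho (beta_span S1 S2).
Proof.
move=> [hS1 inv1] [hS2 inv2]; split.
  split=> [T [T0 _] _ //|k a b Sa Sb T hT TS].
  by apply: hT.2; [exact: Sa|exact: Sb].
move=> g z Sz T hT TS; apply: (Sz (fun z => T (rho g z))) => [|x y S1x S2y].
  split=> [|k a b Ta Tb].
    by rewrite rhoE (islinear0 (lin1 g)) (islinear0 (lin2 g)) addr0; exact: subspace0 hT.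
  suff -> : rho g (k *: a + b) = k *: rho g a + rho g b by exact: hT.2.
  by rewrite !rhoE lin1 lin2 scalerDr addrACA.
rewrite rho_beta; apply: (subspaceD hT); apply: TS => //.
  exact: inv1.
exact: inv2.
Qed.

Lemma full_invariant (U : lmodType R[i]) (r : gen L LF -> U -> U) :
  Defs.invariant r (fun _ => True).
Proof. by []. Qed.

(** The span is invariant and contains [v = beta vac1 vac2], which is nonzero; irreducibility does
    the rest. *)
Lemma beta_span_full z : beta_span (fun _ => True) (fun _ => True) z.
Proof.
case: irr => _ /(_ _ (beta_span_invariant (full_invariant _) (full_invariant _))) [h|]; last exact.
case/eqP: v0; apply: h => T hT TS.
by rewrite -[v]/(val vac2) -beta_vac1; exact: TS.
Qed.

Lemma beta_tensor_product : is_tensor_product beta.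
Proof.
split; first exact: beta_bilinear.
case: beta_bilinear => bl br; move=> W f [fl fr]; split; last first.
  move=> g1 g2 lg1 lg2 e1 e2 z.
  apply: (@beta_span_full z (fun z => g1 z = g2 z)) => [|x y _ _]; last by rewrite e1 e2.
  split=> [|k a b ea eb]; first by rewrite (islinear0 lg1) (islinear0 lg2).
  by rewrite lg1 lg2 ea eb.
have decomp z : exists s : seq (V1 * V2), z = \sum_(p <- s) beta p.1 p.2.
  apply: (@beta_span_full z (fun z => exists s : seq (V1 * V2), z = _)) => [|x y _ _].
    split=> [|k _ _ [s ->] [t ->]]; first by exists [::]; rewrite big_nil.
    exists ([seq (k *: p.1, p.2) | p <- s] ++ t); rewrite big_cat big_map scaler_sumr /=.
    by congr (_ + _); apply: eq_bigr => p _; rewrite (islinearZ (bl _)).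
  by exists [:: (x, y)]; rewrite big_seq1.
have ker (s : seq (V1 * V2)) : \sum_(p <- s) beta p.1 p.2 = 0 -> \sum_(p <- s) f p.1 p.2 = 0.
  move=> s0; apply: (@bilinear_sum_eq0 R V1 V2 W (fun x y => form (val x) (val y))) => //.
    case: hf => h1 [h2 h3]; split=> [w k x y|]; first by rewrite linearP h1.
    split=> [u w|u u0]; first exact: h2.
    by apply: h3; apply: contraNneq u0 => e; apply/eqP/val_inj; rewrite e linear0.
  move=> x; apply: val_inj; rewrite linear0; apply: (form_eq0 hf).
  (* Here [y] is the contraction of the tensor with [x]. Pairing the vanishing sum with [beta x y]
     gives [<y, y> = 0]. *)
  set y := (X in val X).
  have e : \sum_(p <- s) form (val p.1) (val x) * form (val p.2) (val y) = 0.
    rewrite -[RHS](mul0r (form v v)) -[X in _ = X * _](form0l hf (beta x y)) -s0.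
    by rewrite (form_suml hf) mulr_suml; apply: eq_bigr => p _; rewrite form_beta.
  rewrite -[RHS]e {1}/y linear_sum (form_suml hf); apply: eq_bigr => p _.
  by rewrite linearZ (formZl hf).
have ker2 (s t : seq (V1 * V2)) : \sum_(p <- s) beta p.1 p.2 = \sum_(p <- t) beta p.1 p.2 ->
    \sum_(p <- s) f p.1 p.2 = \sum_(p <- t) f p.1 p.2.
  move=> e; apply/eqP; rewrite -subr_eq0; apply/eqP.
  have := ker (s ++ [seq (- p.1, p.2) | p <- t]); rewrite !big_cat !big_map /=.
  rewrite (eq_bigr _ (fun p _ => islinearN (bl p.2) p.1)).
  rewrite (eq_bigr _ (fun p _ => islinearN (fl p.2) p.1)).
  by rewrite !sumrN e subrr; apply.
(* The decomposition is chosen arbitrarily; [ker2] makes the resulting map well defined, hence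
   linear. *)
pose dec z := projT1 (cid (decomp z)).
have decE z : z = \sum_(p <- dec z) beta p.1 p.2 by rewrite /dec; case: cid.
exists (fun z => \sum_(p <- dec z) f p.1 p.2); split=> [k a b|x y].
  have /ker2 -> : \sum_(p <- dec (k *: a + b)) beta p.1 p.2 =
     \sum_(p <- [seq (k *: p.1, p.2) | p <- dec a] ++ dec b) beta p.1 p.2.
    rewrite -decE big_cat big_map {1}(decE a) {1}(decE b) scaler_sumr; congr (_ + _).
    by apply: eq_bigr => p _; rewrite (islinearZ (bl _)).
  rewrite big_cat big_map scaler_sumr /=; congr (_ + _).
  by apply: eq_bigr => p _; rewrite (islinearZ (fl _)).
have /ker2 -> : \sum_(p <- dec (beta x y)) beta p.1 p.2 = \sum_(p <- [:: (x, y)]) beta p.1 p.2.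
  by rewrite -decE big_seq1.
by rewrite big_seq1.
Qed.

Lemma vv0 : form v v != 0.
Proof. by rewrite gt_eqF // (form_gt0 hf). Qed.

(** An invariant [S] spans, together with all of [V2], an invariant subspace of [V]. If that is 0,
    testing against [vac2] gives [S = 0]; if it is [V], projecting orthogonally to [V1] shows that
    [S] is everything. *)
Lemma factor1_irreducible : irreducible factor1.
Proof.
split; first by exists vac1; apply: contraNneq v0 => e; rewrite -[v]/(val vac1) e linear0.
move=> S invS; have [hS _] := invS.
case: irr => _ /(_ _ (beta_span_invariant invS (full_invariant _))) [h|h].
  left=> x Sx; apply: val_inj; rewrite linear0 -beta_vac2; apply: h => T hT TS.
  exact: TS.
right=> x.
(* [T z]: the orthogonal projection of [z] exists and lies in [S]. *)
pose T z := exists2 s, S s & forall x' : V1, form (z - val s) (val x') = 0.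
have [||s Ss e] := h (val x) T.
- split; first by exists 0; [exact: hS.1|move=> x'; rewrite subrr (form0l hf)].
  move=> k a b [s Ss es] [t St et]; exists (k *: s + t) => [|x']; first exact: hS.2.
  rewrite subspace_val_islinear opprD addrACA -scalerBr (formDl hf) (formZl hf).
  by rewrite es et mulr0 addr0.
(* By [form_beta], projecting [beta s y] to [V1] amounts to projecting [y] to the line of [v]. *)
- move=> s y Ss _; exists ((form (val y) v / form v v) *: s).
    by apply: subspaceZ.
  move=> x'; rewrite (islinearZ (@subspace_val_islinear _ _ _ _)) (formBl hf) (formZl hf).
  apply/eqP; rewrite subr_eq0; apply/eqP.
  by apply: (mulIf vv0); rewrite -{1}(beta_vac2 x') form_beta mulrAC divfK ?vv0 // mulrC.
- suff -> : x = s by [].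
  by apply/eqP; rewrite -subr_eq0; apply/eqP/val_inj; rewrite linear0; apply: (form_eq0 hf);
    rewrite -(e (x - s)) linearB.
Qed.

Lemma factor2_irreducible : irreducible factor2.
Proof.
split; first by exists vac2; apply: contraNneq v0 => e; rewrite -[v]/(val vac2) e linear0.
move=> S invS; have [hS _] := invS.
case: irr => _ /(_ _ (beta_span_invariant (full_invariant _) invS)) [h|h].
  left=> x Sx; apply: val_inj; rewrite linear0 -beta_vac1; apply: h => T hT TS.
  exact: TS.
right=> x.
pose T z := exists2 s, S s & forall x' : V2, form (z - val s) (val x') = 0.
have [||s Ss e] := h (val x) T.
- split; first by exists 0; [exact: hS.1|move=> x'; rewrite subrr (form0l hf)].
  move=> k a b [s Ss es] [t St et]; exists (k *: s + t) => [|x']; first exact: hS.2.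
  rewrite subspace_val_islinear opprD addrACA -scalerBr (formDl hf) (formZl hf).
  by rewrite es et mulr0 addr0.
- move=> y s _ Ss; exists ((form (val y) v / form v v) *: s).
    by apply: subspaceZ.
  move=> x'; rewrite (islinearZ (@subspace_val_islinear _ _ _ _)) (formBl hf) (formZl hf).
  apply/eqP; rewrite subr_eq0; apply/eqP.
  by apply: (mulIf vv0); rewrite -{1}(beta_vac1 x') form_beta mulrAC divfK ?vv0 // mulrC.
- suff -> : x = s by [].
  by apply/eqP; rewrite -subr_eq0; apply/eqP/val_inj; rewrite linear0; apply: (form_eq0 hf);
    rewrite -(e (x - s)) linearB.
Qed.

Lemma factor1_generates : generates factor1 vac1.
Proof. by apply: restr_generates => T [hT inv] Tv _ [P aP ->]; apply: opalg_stable aP Tv. Qed.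

Lemma factor2_generates : generates factor2 vac2.
Proof. by apply: restr_generates => T [hT inv] Tv _ [P aP ->]; apply: opalg_stable aP Tv. Qed.
End Factorization.


(** * Lowest weights of unitary representations *)

Lemma natr_count (C : pzSemiRingType) (T : eqType) (r : seq T) (y : T) :
  (count_mem y r)%:R = \sum_(z <- r) (z == y)%:R :> C.
Proof. by rewrite -sumn_count sumnE big_map natr_sum. Qed.

Lemma seq1_count (T : eqType) (s : seq T) (x : T) :
  (forall y, count_mem y s = (y == x)) -> s = [:: x].
Proof.
move=> e; apply/perm_small_eq => //; apply/allP => y _ /=; apply/eqP.
by rewrite e addn0 eq_sym.
Qed.

(** * Formal combinations and their coefficients *)

Section Coefficients.
Variables (R : realType) (L LF : nat).
Local Notation C := R[i].
Implicit Types (a : comb R L LF) (e : basis L LF) (w : vect R L LF).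

Lemma coef_opimg a e e' :
  coef (opimg a e) e' = \sum_(p <- a) p.1 * (count_mem e' (gact p.2 e))%:R.
Proof.
rewrite /coef /opimg big_flatten big_map; apply: eq_bigr => p _.
rewrite big_map -sum1_count natr_sum mulr_sumr [LHS](bigID (fun b => b == e')) /=.
rewrite addrC big1 ?add0r => [|b /negbTE ->//].
by apply: eq_bigr => b /= ->; rewrite mulr1.
Qed.

Lemma coef_opapp a w e' :
  coef (opapp a w) e' = \sum_(q <- w) q.1 * coef (opimg a q.2) e'.
Proof.
rewrite /coef /opapp big_flatten big_map; apply: eq_bigr => q _.
rewrite big_map mulr_sumr; apply: eq_bigr => p _ /=.
by case: ifP => _; rewrite ?mulr0.
Qed.

Lemma sum_coef (V : lmodType C) (F : basis L LF -> V) w s : uniq s ->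
  {subset [seq p.2 | p <- w] <= s} ->
  \sum_(p <- w) p.1 *: F p.2 = \sum_(e <- s) coef w e *: F e.
Proof.
move=> us ws; under [RHS]eq_bigr => e _ do rewrite /coef scaler_suml.
rewrite exchange_big /= !big_seq; apply: eq_bigr => p pw.
rewrite (bigD1_seq p.2) ?ws ?map_f //= eqxx big1 ?addr0 // => e.
by rewrite eq_sym => /negbTE ->; rewrite scale0r.
Qed.

(** Carries identities of operators on [T_o], known coefficient by coefficient, over to [V]: lists
    with repetitions are regrouped over a common support. *)
Lemma eq_sum_coef (V : lmodType C) (F : basis L LF -> V) w1 w2 :
  coef w1 =1 coef w2 -> \sum_(p <- w1) p.1 *: F p.2 = \sum_(p <- w2) p.1 *: F p.2.
Proof.
move=> e; pose s := undup ([seq p.2 | p <- w1] ++ [seq p.2 | p <- w2]).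
rewrite !(@sum_coef V F _ s) ?undup_uniq //; first by apply: eq_bigr => x _; rewrite e.
- by move=> x xw; rewrite mem_undup mem_cat xw orbT.
- by move=> x xw; rewrite mem_undup mem_cat xw.
Qed.
End Coefficients.

Section Representation.
Variables (R : realType) (L LF : nat) (V : lmodType R[i]) (rho : gen L LF -> V -> V).
Hypothesis hrep : is_rep rho.
Local Notation M a b := (rho (munit a b)).
Local Notation basis := (basis L LF).

Lemma rep_islinear g : islinear (rho g).
Proof. exact: hrep.1. Qed.

(** On [T_o], [X E_ab] is the sum of [X_ca E_cb] and [E_ab X] the sum of [X_bd E_ad]. Row [b] of [X]
    is read off as column [b] of its transpose [omega g], so both sums are finite. *)
Lemma rep_bracket_munit g (a b : basis) x :
  rho g (M a b x) - M a b (rho g x) =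
  \sum_(c <- gact g a) M c b x - \sum_(d <- gact (omega g) b) M a d x.
Proof.
pose s : comb R L LF := [seq (1, munit c b) | c <- gact g a] ++
  [seq (-1, munit a d) | d <- gact (omega g) b].
have := hrep.2 [:: (1, g)] [:: (1, munit a b)] s.
have rhoC1 k y : rhoC rho [:: (1, k)] y = rho k y by rewrite /rhoC big_seq1 scale1r.
move=> /(_ _ x); rewrite !rhoC1 => ->.
  rewrite /rhoC big_cat !big_map -sumrN; congr (_ + _); apply: eq_bigr => c _.
    by rewrite scale1r.
  by rewrite scaleN1r.
have cntM (a' b' e e' : basis) : (count_mem e' (gact (munit a' b') e))%:R =
    (e == b')%:R * (a' == e')%:R :> R[i].
  by rewrite gact_munit; case: (e == b'); rewrite /= ?mul0r // mul1r addn0.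
have opimg1 (k : gen L LF) y y' :
    coef (opimg [:: (1, k)] y) y' = (count_mem y' (gact k y))%:R :> R[i].
  by rewrite coef_opimg big_seq1 mul1r.
have opapp1 (k k' : gen L LF) e e' :
    coef (opapp [:: (1, k)] (opimg [:: (1, k')] e)) e' =
    \sum_(y <- gact k' e) (count_mem e' (gact k y))%:R :> R[i].
  rewrite [opimg _ e](_ : _ = [seq (1, y) | y <- gact k' e]); last by rewrite /opimg /= cats0.
  rewrite coef_opapp big_map.
  by apply: eq_bigr => y _; rewrite mul1r opimg1.
move=> e e'; rewrite !opapp1 coef_opimg big_cat !big_map /=.
under [X in _ - X = _]eq_bigr => y _ do rewrite cntM.
under [X in _ = X + _]eq_bigr => y _ do rewrite mul1r cntM.
under [X in _ = _ + X]eq_bigr => y _ do rewrite mulN1r cntM (eq_sym e).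
rewrite sumrN -!mulr_suml -mulr_sumr -!natr_count count_gact_omega gact_munit.
by case: (e == b); rewrite ?big_seq1 ?mul1r // big_nil mul0r.
Qed.

Lemma rep_bracket_munit2 (a b c d : basis) x :
  M a b (M c d x) - M c d (M a b x) =
  (b == c)%:R *: M a d x - (d == a)%:R *: M c b x.
Proof.
rewrite rep_bracket_munit omega_munit !gact_munit (eq_sym c).
congr (_ - _); last first.
  by case: (d == a); rewrite ?big_seq1 ?scale1r // big_nil scale0r.
by case: (b == c); rewrite ?big_seq1 ?scale1r // big_nil scale0r.
Qed.

(** * Integrality and boundedness of the weights *)

Section LowestWeight.
Variables (form : V -> V -> R[i]) (h : gen L LF -> R) (v : V).
Hypothesis hf : hermitian_pd form.
Hypothesis adj : forall g u w, form (rho g u) w = form u (rho (omega g) w).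
Hypothesis hv : lowest_weight_vector rho h v.

Local Notation hw b := (h (munit b b)).

Lemma lw_neq0 : v != 0. Proof. by case: hv. Qed.

Lemma lw_neg (a b : basis) : bless a b -> M a b v = 0.
Proof. by case: hv => _ [neg _] /neg. Qed.

Lemma lw_diag (b : basis) : M b b v = (hw b)%:C%C *: v.
Proof. by case: hv => _ [_]; apply; exact: diagonal_munit. Qed.

(** The sl(2) string [X k = E_ba^k v]: the norm of [X k.+1] is [(k+1) (h_a - h_b - k)] times that of
    [X k], and positivity forces the string to stop at [k = h_a - h_b]. *)
Lemma weight_difference_nat (a b : basis) : bless a b -> exists n : nat, hw a - hw b = n%:R.
Proof.
move=> ab; have nab := bless_neq ab; have nba : (b == a) = false by rewrite eq_sym.
pose X k := iter k (M b a) v.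
have XS k : X k.+1 = M b a (X k) by [].
have wta k : M a a (X k) = (hw a - k%:R)%:C%C *: X k.
  elim: k => [|k IH]; first by rewrite subr0 lw_diag.
  have /eqP := rep_bracket_munit2 a a b a (X k).
  rewrite nab eqxx scale0r scale1r add0r subr_eq -XS IH (islinearZ (rep_islinear _)) -XS.
  move/eqP => ->; rewrite -[in - _](scale1r (X k.+1)) -scaleNr -scalerDl.
  by congr (_ *: _); rewrite -natr1 opprD addrA !rmorphB /= rmorph1 addrC.
have wtb k : M b b (X k) = (hw b + k%:R)%:C%C *: X k.
  elim: k => [|k IH]; first by rewrite addr0 lw_diag.
  have /eqP := rep_bracket_munit2 b b b a (X k).
  rewrite nab eqxx scale0r scale1r subr0 subr_eq -XS IH (islinearZ (rep_islinear _)) -XS.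
  move/eqP => ->; rewrite -[in X in X + _](scale1r (X k.+1)) -scalerDl.
  by congr (_ *: _); rewrite -natr1 addrA !rmorphD /= rmorph1 addrC.
have low k : M a b (X k.+1) = (k.+1%:R * (hw a - hw b - k%:R))%:C%C *: X k.
  elim: k => [|k IH].
    have /eqP := rep_bracket_munit2 a b b a v.
    rewrite !eqxx !scale1r (lw_neg ab) (islinear0 (rep_islinear _)) subr0 => /eqP ->.
    by rewrite !lw_diag -scalerBl -rmorphB subr0 mul1r.
  have /eqP := rep_bracket_munit2 a b b a (X k.+1).
  rewrite !eqxx !scale1r IH (islinearZ (rep_islinear _)) -!XS subr_eq => /eqP ->.
  rewrite wta wtb -scalerBl -rmorphB -scalerDl -rmorphD; congr (_%:C%C *: _).
  by rewrite -!natr1; ring.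
have normS k : form (X k.+1) (X k.+1) =
    (k.+1%:R * (hw a - hw b - k%:R))%:C%C * form (X k) (X k).
  rewrite {1}XS adj omega_munit low (formZr hf); congr (_ * _).
  exact: conjc_real.
(* If the difference is no natural number, no [X k] vanishes, and positive norms put every [k] below
   the difference, against the Archimedean property. *)
apply: contrapT => /forallNP nat_free.
have Xn0 k : X k != 0.
  elim: k => [|k IH]; first exact: lw_neq0.
  apply/eqP => e; apply: (nat_free k); have /eqP := normS k.
  rewrite e (form0l hf) eq_sym mulf_eq0 => /orP[|]; last by rewrite gt_eqF // (form_gt0 hf).
  by rewrite fmorph_eq0 mulf_eq0 pnatr_eq0 /= subr_eq0 => /eqP.
have mk k : k%:R < hw a - hw b.
  have := form_gt0 hf (Xn0 k.+1); rewrite normS pmulr_lgt0 ?(form_gt0 hf (Xn0 k)) //.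
  by rewrite ltcR pmulr_rgt0 ?ltr0n // subr_gt0.
by have := archi_boundP (ltW (mk 0%N)); rewrite ltNge (ltW (mk _)).
Qed.

(** The commutator of [E_ab] and [E_ba] is [E_aa - E_bb]. For equal weights the raised vector is
    therefore 0. *)
Lemma norm_raising (a b : basis) (u : V) (x y : R) : M a b u = 0 ->
  M a a u = x%:C%C *: u -> M b b u = y%:C%C *: u ->
  form (M b a u) (M b a u) = (x - y)%:C%C * form u u.
Proof.
move=> eab ea eb; rewrite adj omega_munit.
have /eqP := rep_bracket_munit2 a b b a u.
rewrite eab (islinear0 (rep_islinear _)) subr0 !eqxx !scale1r ea eb -scalerBl -rmorphB.
by move=> /eqP ->; rewrite (formZr hf) /= oppr0.
Qed.

Variables (o : 'I_L) (l0 : 'I_LF).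
(** Words of unbounded length on which the operator inserting [o] in front acts as a one-step
    shift. *)
Let chain (n : nat) : basis := (l0, nseq n o, l0).

Lemma chain_inj : injective chain.
Proof. by move=> n m [/(congr1 size)]; rewrite !size_nseq. Qed.

Lemma chain_bless n m : (n < m)%N -> bless (chain n) (chain m).
Proof. by move=> nm; apply: bless_ltdeg; rewrite /deg /= !size_nseq. Qed.

(* Bessel's inequality: the vectors [u n] are orthogonal, and
   [form (rho g v) (u n)] and [form (u n) (u n)] both equal [d n * form v v]. *)
Lemma chain_weight_bound : exists D : R, forall N, hw (chain 0) - hw (chain N) <= D.
Proof.
pose g : gen L LF := GII l0 l0 [:: o] [::].
have gactg n : gact g (chain n) = [:: chain n.+1].
  by apply: seq1_count => e; rewrite count_gactGII eqxx take0 drop0.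
have gactog n : gact (omega g) (chain n.+1) = [:: chain n].
  by apply: seq1_count => e; rewrite count_gactGII eqxx /= take0 drop0 eqxx.
pose u n := M (chain n.+1) (chain n) v.
pose d n := hw (chain n) - hw (chain n.+1).
(* [omega g] shortens words and so kills [v]; its bracket with the matrix unit from step [n] to step
   [n+1] is the difference of two diagonal units, which gives [d n]. *)
have gvu n : form (rho g v) (u n) = (d n)%:C%C * form v v.
  have /eqP := rep_bracket_munit (omega g) (chain n.+1) (chain n) v.
  rewrite omegaK gactg gactog !big_seq1 (_ : rho (omega g) v = 0); last by case: hv => _ [->].
  rewrite (islinear0 (rep_islinear _)) subr0 !lw_diag -scalerBl -rmorphB adj => /eqP ->.
  by rewrite (formZr hf) /= oppr0.
have uu n m : form (u m) (u n) = (n == m)%:R * ((d n)%:C%C * form v v).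
  rewrite adj omega_munit.
  have /eqP := rep_bracket_munit2 (chain m) (chain m.+1) (chain n.+1) (chain n) v.
  rewrite (lw_neg (chain_bless (ltnSn m))) (islinear0 (rep_islinear _)) subr0 => /eqP ->.
  rewrite !(inj_eq chain_inj) eqSS (eq_sym m); case: (n =P m) => [->|_].
    rewrite !scale1r !lw_diag -scalerBl -rmorphB (formZr hf) mul1r; congr (_ * _).
    exact: conjc_real.
  by rewrite !scale0r subr0 (form0r hf) mul0r.
have bound N : (hw (chain 0) - hw (chain N))%:C%C * form v v <= form (rho g v) (rho g v).
  (* Since [<g v, u n> = <u n, u n>], the orthogonal projection has coefficients 1, even where
     [u n = 0]. *)
  pose w := rho g v - \sum_(n < N) u n.
  have wu (n : 'I_N) : form w (u n) = 0.
    rewrite (formBl hf) (form_suml hf) gvu (bigD1 n) //= uu eqxx mul1r.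
    rewrite big1 ?addr0 ?subrr // => m /negbTE nm.
    by rewrite uu eq_sym (inj_eq val_inj) nm mul0r.
  have := form_ge0 hf w; rewrite {2}/w (formBr hf) (form_sumr hf) big1 // subr0.
  rewrite (formBl hf) (form_suml hf) subr_ge0.
  suff -> : \sum_(n < N) form (u n) (rho g v) =
     (hw (chain 0) - hw (chain N))%:C%C * form v v by [].
  have -> : hw (chain 0) - hw (chain N) = \sum_(0 <= n < N) d n.
    rewrite (telescope_sumr_eq (fun n => - hw (chain n)) d) //; first by rewrite opprK addrC.
    by move=> n _; rewrite opprK addrC.
  rewrite big_mkord rmorph_sum mulr_suml; apply: eq_bigr => n _.
  by rewrite (form_conj hf) gvu rmorphM /= oppr0 -(form_conj hf).
have [eF eD] : form v v = (complex.Re (form v v))%:C%C /\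
    form (rho g v) (rho g v) = (complex.Re (form (rho g v) (rho g v)))%:C%C.
  by rewrite !RRe_real // ger0_real // (form_ge0 hf).
have F0 : 0 < complex.Re (form v v).
  by rewrite -(ltcR 0) -eF (form_gt0 hf lw_neq0).
exists (complex.Re (form (rho g v) (rho g v)) / complex.Re (form v v)) => N.
by have := bound N; rewrite eF eD -rmorphM lecR ler_pdivlMr.
Qed.

Lemma bounded_nat_eventually_const (k : nat -> nat) (B : nat) :
  (forall n m, (n <= m)%N -> (k n <= k m)%N) -> (forall n, (k n <= B)%N) ->
  exists N, forall m, (N <= m)%N -> k m = k N.
Proof.
move=> mono bd; have exP : exists j, `[< exists n, k n = j >].
  by exists (k 0%N); apply/asboolP; exists 0%N.
have bdP j : `[< exists n, k n = j >] -> (j <= B)%N by move/asboolP => [n <-].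
case: (ex_maxnP exP bdP) => _ /asboolP[N <-] maxN; exists N => m Nm.
by apply/eqP; rewrite eqn_leq (mono _ _ Nm) andbT maxN //; apply/asboolP; exists m.
Qed.

(** Along the chain the weights decrease by natural numbers with bounded total, so they stabilise.
    Any other long [b] is squeezed between two members of the chain. *)
Lemma weight_eventually_const : exists (c : R) (N : nat),
  forall b : basis, (N <= deg b)%N -> hw b = c.
Proof.
have [D bd] := chain_weight_bound.
have nat_diff n : exists j : nat, hw (chain 0) - hw (chain n) = j%:R.
  by case: n => [|n]; [exists 0%N; rewrite subrr|exact/weight_difference_nat/chain_bless].
have [k kE] := choice nat_diff.
have hwE n : hw (chain n) = hw (chain 0) - (k n)%:R by rewrite -kE subKr.
have wdec a b : bless a b -> hw b <= hw a.
  by move=> /weight_difference_nat[j e]; rewrite -subr_ge0 e ler0n.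
have [|n|N kN] := @bounded_nat_eventually_const k (Num.bound D).
- move=> n m; rewrite leq_eqVlt => /predU1P[->//|/chain_bless/wdec].
  by rewrite (hwE n) (hwE m) lerD2l lerN2 ler_nat.
- rewrite -(ler_nat R) -kE (le_trans (bd n)) // ltW //; apply: archi_boundP.
  by have := bd 0%N; rewrite subrr.
(* The successor makes [deg b] strictly larger than the length of [chain N], as [bless_ltdeg]
   asks. *)
exists (hw (chain N)), N.+1 => b Nb; apply/eqP; rewrite eq_le; apply/andP; split.
  by apply/wdec/bless_ltdeg; rewrite {1}/deg /= size_nseq.
have -> : hw (chain N) = hw (chain (deg b).+1).
  by rewrite (hwE N) (hwE (deg b).+1) (kN (deg b).+1) // ltnW // ltnW.
by apply/wdec/bless_ltdeg; rewrite {2}/deg /= size_nseq.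
Qed.

End LowestWeight.

End Representation.


(** * The splitting [rho = rho1 + rho2] *)

(** Turns a sum over a list into a sum over a fixed set weighted by matrix entries, so that
    [count_gact_omega] can exchange rows and columns. *)
Lemma sum_count_seq (W : nmodType) (T : eqType) (r s : seq T) (G : T -> W) : uniq s ->
  (forall d, d \in r -> d \notin s -> G d = 0) ->
  \sum_(d <- r) G d = \sum_(e <- s) G e *+ count_mem e r.
Proof.
move=> us; elim: r => [|d r IH] hG; first by rewrite big_nil big1.
rewrite big_cons IH => [|x xr]; last by apply: hG; rewrite inE xr orbT.
under [RHS]eq_bigr => e _ do rewrite /= mulrnDr.
rewrite big_split /=; congr (_ + _); have [ds|ds] := boolP (d \in s).
  rewrite (bigD1_seq d) //= eqxx big1 ?addr0 // => e.
  by rewrite eq_sym => /negbTE ->.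
rewrite hG ?mem_head // big_seq big1 // => e es.
by case: eqP => // de; rewrite de es in ds.
Qed.

Lemma ball_sum (L LF : nat) (W : nmodType) (G : basis L LF -> W) n m : (n <= m)%N ->
  (forall e, (n <= deg e)%N -> G e = 0) ->
  \sum_(e <- ball L LF m) G e = \sum_(e <- ball L LF n) G e.
Proof.
move=> nm G0; rewrite (bigID (fun e => e \in ball L LF n)) /= [X in _ + X]big1 ?addr0.
  rewrite -big_filter; apply: perm_big; apply: uniq_perm; rewrite ?filter_uniq ?ball_uniq //.
  move=> e; rewrite mem_filter !mem_ball; case: ltnP => //= en.
  by rewrite (leq_trans en nm).
by move=> e; rewrite mem_ball -leqNgt; exact: G0.
Qed.

Section Twist.
Variables (R : realType) (L LF : nat) (V : lmodType R[i]) (rho : gen L LF -> V -> V).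
Hypothesis hrep : is_rep rho.
Local Notation M a b := (rho (munit a b)).
Local Notation basis := (basis L LF).
Local Notation ball := (ball L LF).
Variables (c : R).

(** The twisted unit [E'_ab]. *)
Definition tm (a b : basis) (u : V) : V := M a b u - ((a == b)%:R * c%:C%C) *: u.

Lemma tm_islinear a b : islinear (tm a b).
Proof.
move=> k x y; rewrite /tm (rep_islinear hrep) scalerDr scalerBr !scalerA opprD addrACA.
by congr (_ - _ *: _ + _); rewrite mulrC.
Qed.

Lemma sum_delta_scale (r : seq basis) (b : basis) (k : R[i]) (x : V) :
  \sum_(e <- r) ((e == b)%:R * k) *: x = ((count_mem b r)%:R * k) *: x.
Proof. by rewrite -scaler_suml -mulr_suml -natr_count. Qed.

(** The scalar shift drops out of the bracket. On the right, both sums change by [c] times the same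
    entry [X_ba], so the changes cancel. *)
Lemma rho_tm g (a b : basis) x :
  rho g (tm a b x) - tm a b (rho g x) =
  \sum_(e <- gact g a) tm e b x - \sum_(d <- gact (omega g) b) tm a d x.
Proof.
rewrite {1 2}/tm (islinearB (rep_islinear hrep g)) (islinearZ (rep_islinear hrep g)).
rewrite opprB addrA subrK (rep_bracket_munit hrep) !sumrB opprB.
under [X in _ = _ - _ + (X - _)]eq_bigr do rewrite eq_sym.
by rewrite !sum_delta_scale count_gact_omega addrA subrK.
Qed.

Lemma tm_bracket (a b d e : basis) x :
  tm a b (tm d e x) - tm d e (tm a b x) =
  (b == d)%:R *: tm a e x - (e == a)%:R *: tm d b x.
Proof.
rewrite [tm a b (tm d e x)]/tm [tm a b x]/tm (islinearB (tm_islinear d e)).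
rewrite (islinearZ (tm_islinear d e)).
rewrite opprB addrA subrK rho_tm omega_munit !gact_munit (eq_sym d).
congr (_ - _); last first.
  by case: (e == a); rewrite ?big_seq1 ?scale1r // big_nil scale0r.
by case: (b == d); rewrite ?big_seq1 ?scale1r // big_nil scale0r.
Qed.

(** Only columns of length below [n] act on [u]; this is what makes the sum of the [X_ab E'_ab]
    finite on [u]. *)
Definition local (n : nat) (u : V) : Prop :=
  forall a b : basis, (n <= deg b)%N -> tm a b u = 0.

Lemma local_mono n m u : (n <= m)%N -> local n u -> local m u.
Proof. by move=> nm lu a b mb; apply: lu; exact: leq_trans mb. Qed.

Lemma local_subspace n : subspace (local n).
Proof.
split=> [a b _|k x y lx ly a b nb]; first exact: islinear0 (tm_islinear a b).
by rewrite tm_islinear lx // ly // scaler0 addr0.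
Qed.

Lemma mem_gact_omega (g : gen L LF) (d b : basis) :
  (d \in gact (omega g) b) = (b \in gact g d).
Proof. by rewrite -!has_pred1 !has_count count_gact_omega omegaK. Qed.

(** The bracket of [g] with [E'_ab] involves only column [b] and the columns [d] with [X_bd]
    nonzero, and such a [d] is shorter than [b] by at most [gen_shift g]. *)
Lemma local_rho g n u : local n u -> local (n + gen_shift g) (rho g u).
Proof.
move=> lu a b nb; have /eqP := rho_tm g a b u.
rewrite lu ?(leq_trans (leq_addr _ _) nb) // (islinear0 (rep_islinear hrep g)) sub0r.
rewrite [X in _ == X - _]big1 => [|e _]; last by rewrite lu // (leq_trans (leq_addr _ _) nb).
rewrite sub0r eqr_opp => /eqP ->; rewrite big_seq big1 // => d.
rewrite mem_gact_omega => /deg_gact bd; apply: lu.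
by rewrite -(leq_add2r (gen_shift g)) (leq_trans nb).
Qed.

Lemma local_tm a b n u : local n u -> local (n + deg a) (tm a b u).
Proof.
move=> lu; rewrite /tm; apply: (subspaceB (local_subspace _)).
  exact: (@local_rho (munit a b)) lu.
by apply: (subspaceZ (local_subspace _)); apply: local_mono lu; exact: leq_addr.
Qed.

Hypothesis loc : forall u, exists n, local n u.

Definition locdeg (u : V) : nat := projT1 (cid (loc u)).

Lemma locdegP u : local (locdeg u) u.
Proof. by rewrite /locdeg; case: cid. Qed.
Arguments locdegP : clear implicits.

(* [ball (locdeg u)] is merely a finite set of columns large enough for [u]: by
   [rho1E] any larger ball gives the same value. *)
Definition rho1 (g : gen L LF) (u : V) : V :=
  \sum_(e <- ball (locdeg u)) \sum_(a <- gact g e) tm a e u.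

Lemma rho1E n g u : local n u ->
  rho1 g u = \sum_(e <- ball n) \sum_(a <- gact g e) tm a e u.
Proof.
move=> lu; pose G e := \sum_(a <- gact g e) tm a e u.
rewrite -[LHS](@ball_sum _ _ _ G _ (maxn n (locdeg u))) ?leq_maxr // => [|e le].
  apply: ball_sum; first exact: leq_maxl.
  by move=> e ne; rewrite /G big1 // => a _; exact: lu.
by rewrite /G big1 // => a _; exact: locdegP.
Qed.

Lemma rho1_islinear g : islinear (rho1 g).
Proof.
move=> k x y; pose n := maxn (locdeg x) (locdeg y).
have lx : local n x by exact: (local_mono (leq_maxl _ _) (locdegP x)).
have ly : local n y by exact: (local_mono (leq_maxr _ _) (locdegP y)).
rewrite (rho1E g ((local_subspace n).2 k x y lx ly)) (rho1E g lx) (rho1E g ly).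
rewrite scaler_sumr -big_split; apply: eq_bigr => e _ /=.
by rewrite scaler_sumr -big_split; apply: eq_bigr => a _; exact: tm_islinear.
Qed.

Lemma rho1_munit a b u : rho1 (munit a b) u = tm a b u.
Proof.
have lu : local (maxn (locdeg u) (deg b).+1) u by exact: (local_mono (leq_maxl _ _) (locdegP u)).
rewrite (rho1E _ lu) (bigD1_seq b) ?ball_uniq ?mem_ball ?leq_maxr //=.
rewrite gact_munit eqxx big_seq1 big1 ?addr0 // => e /negbTE eb.
by rewrite gact_munit eb big_nil.
Qed.

(** The right side is that of [rho_tm], so [rho - rho1] commutes with every [E'_ab]. *)
Lemma rho1_tm g (a b : basis) x :
  rho1 g (tm a b x) - tm a b (rho1 g x) =
  \sum_(e <- gact g a) tm e b x - \sum_(d <- gact (omega g) b) tm a d x.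
Proof.
(* Large enough for [x], for [tm a b x], for column [a], and for every [d] with a nonzero entry in
   row [b]. *)
pose n := (locdeg x + deg a + deg b + gen_shift (omega g)).+1.
have lx : local n x by apply: (local_mono _ (locdegP x)); rewrite /n; lia.
have ltx : local n (tm a b x).
  by apply: (@local_mono (locdeg x + deg a)); [rewrite /n; lia|exact: (@local_tm a b _ x (locdegP x))].
rewrite (rho1E g lx) (rho1E g ltx) (islinear_sum (tm_islinear a b)) -sumrB.
transitivity (\sum_(e <- ball n) ((e == a)%:R *: (\sum_(f <- gact g e) tm f b x) -
    tm a e x *+ count_mem b (gact g e))).
  apply: eq_bigr => e _; rewrite (islinear_sum (tm_islinear a b)) -sumrB.
  under eq_bigr => f _ do rewrite tm_bracket (eq_sym b).
  by rewrite sumrB -scaler_sumr -scaler_suml -natr_count !scaler_nat.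
rewrite sumrB; congr (_ - _).
  rewrite (bigD1_seq a) ?ball_uniq ?mem_ball //=; last by rewrite /n; lia.
  by rewrite eqxx scale1r [X in _ + X]big1 ?addr0 // => e /negbTE ->; rewrite scale0r.
rewrite [RHS](@sum_count_seq _ _ _ (ball n)) ?ball_uniq // => [|d].
  by apply: eq_bigr => e _; rewrite count_gact_omega.
by move=> /deg_gact bd; rewrite mem_ball /n; lia.
Qed.
(** Expand [rho1 k] into twisted units and apply [rho1_tm] to each; exchanging rows and columns in
    the second half produces the columns of the product taken in the other order. *)
Lemma rho1_bracket g k n u : local n u ->
  rho1 g (rho1 k u) - rho1 k (rho1 g u) =
  \sum_(e <- ball n) (\sum_(f <- gact k e) \sum_(x <- gact g f) tm x e u -
                      \sum_(f <- gact g e) \sum_(x <- gact k f) tm x e u).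
Proof.
(* The larger radius also contains everything that [g] reaches from [ball n]. *)
move=> lu; pose m := maxn (n + gen_shift g) (locdeg (rho1 g u)).
have lum : local m u by apply: (local_mono _ lu); rewrite /m; lia.
have lgm : local m (rho1 g u) by exact: (local_mono (leq_maxr _ _) (locdegP _)).
rewrite (rho1E k lum) (rho1E k lgm) (islinear_sum (rho1_islinear g)) -sumrB.
pose T k' d := \sum_(x <- gact k' d) tm x d u.
transitivity (\sum_(e <- ball m) (\sum_(f <- gact k e) \sum_(x <- gact g f) tm x e u -
    \sum_(d <- ball n) (\sum_(f <- gact k e) tm f d u) *+ count_mem e (gact g d))).
  apply: eq_bigr => e _; rewrite (islinear_sum (rho1_islinear g)) -sumrB.
  under eq_bigr => f _ do rewrite rho1_tm.
  rewrite sumrB; congr (_ - _); rewrite exchange_big /=.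
  rewrite (@sum_count_seq _ _ _ (ball n)) ?ball_uniq // => [|d _].
    by apply: eq_bigr => d _; rewrite count_gact_omega omegaK.
  by rewrite mem_ball -leqNgt => nd; rewrite big1 // => f _; exact: lu.
rewrite !sumrB; congr (_ - _).
  apply: ball_sum => [|e ne]; first by rewrite /m; lia.
  by rewrite big1 // => f _; rewrite big1 // => x _; exact: lu.
rewrite exchange_big big_seq [RHS]big_seq /=; apply: eq_bigr => d.
rewrite mem_ball => dn; rewrite [RHS](@sum_count_seq _ _ _ (ball m)) ?ball_uniq // => e.
by move/deg_gact => ed; rewrite mem_ball /m; lia.
Qed.

Lemma rhoC_rho1 (a : comb R L LF) n u : local n u ->
  rhoC rho1 a u = \sum_(e <- ball n) \sum_(p <- opimg a e) p.1 *: tm p.2 e u.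
Proof.
move=> lu; rewrite /rhoC; under eq_bigr => p _ do rewrite (rho1E p.2 lu) scaler_sumr.
rewrite exchange_big; apply: eq_bigr => e _ /=.
rewrite /opimg big_flatten big_map; apply: eq_bigr => p _.
by rewrite big_map scaler_sumr.
Qed.

Lemma rhoC_comp (r : gen L LF -> V -> V) (a b : comb R L LF) u : (forall g, islinear (r g)) ->
  rhoC r a (rhoC r b u) = \sum_(p <- a) \sum_(q <- b) (p.1 * q.1) *: r p.2 (r q.2 u).
Proof.
move=> rlin; apply: eq_bigr => p _; rewrite (islinear_sum (rlin _)) scaler_sumr.
by apply: eq_bigr => q _; rewrite (islinearZ (rlin _)) scalerA.
Qed.

Lemma sum_opapp (W : lmodType R[i]) (F : basis -> W) (a b : comb R L LF) e :
  \sum_(p <- opapp a (opimg b e)) p.1 *: F p.2 =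
  \sum_(p <- a) \sum_(q <- b) (p.1 * q.1) *:
    \sum_(f <- gact q.2 e) \sum_(x <- gact p.2 f) F x.
Proof.
rewrite exchange_big /opapp big_flatten big_map {1}/opimg big_flatten big_map.
apply: eq_bigr => q _; rewrite big_map /=.
under [RHS]eq_bigr => p _ do rewrite scaler_sumr.
rewrite exchange_big; apply: eq_bigr => f _ /=.
rewrite big_map /opimg big_flatten big_map; apply: eq_bigr => p _.
by rewrite big_map scaler_sumr; apply: eq_bigr => x _; rewrite mulrC.
Qed.

(** By [rho1_bracket] both sides are sums over columns [e]; in each column they have equal
    coefficients by the relation on [T_o], so [eq_sum_coef] applies. *)
Lemma rho1_is_rep : is_rep rho1.
Proof.
split=> [g|a b d abd u]; first exact: rho1_islinear.
have lu := locdegP u; set n := locdeg u in lu.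
rewrite !rhoC_comp; try exact: rho1_islinear.
rewrite [X in _ - X]exchange_big -sumrB (rhoC_rho1 d lu).
transitivity (\sum_(p <- a) \sum_(q <- b) \sum_(e <- ball n) (p.1 * q.1) *:
   (\sum_(f <- gact q.2 e) \sum_(x <- gact p.2 f) tm x e u -
    \sum_(f <- gact p.2 e) \sum_(x <- gact q.2 f) tm x e u)).
  apply: eq_bigr => p _; rewrite -sumrB; apply: eq_bigr => q _.
  by rewrite [q.1 * _]mulrC -scalerBr (rho1_bracket _ _ lu) scaler_sumr.
under eq_bigr => p _ do rewrite exchange_big.
rewrite exchange_big; apply: eq_bigr => e _ /=.
pose F x := tm x e u.
have := @eq_sum_coef R L LF V F (opapp a (opimg b e))
  (opapp b (opimg a e) ++ opimg d e).
rewrite big_cat !sum_opapp /= => e1.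
transitivity (\sum_(p <- a) \sum_(q <- b) (p.1 * q.1) *:
    \sum_(f <- gact q.2 e) \sum_(x <- gact p.2 f) F x -
    \sum_(p <- b) \sum_(q <- a) (p.1 * q.1) *:
    \sum_(f <- gact q.2 e) \sum_(x <- gact p.2 f) F x).
  rewrite [X in _ - X]exchange_big -sumrB; apply: eq_bigr => p _.
  by rewrite -sumrB; apply: eq_bigr => q _; rewrite [q.1 * _]mulrC -scalerBr.
rewrite e1; first by rewrite addrAC subrr add0r.
move=> e'; rewrite {2}/coef big_cat -!/(coef _ _) /= -(abd e e') addrC subrK //.
Qed.

Definition rho2 (g : gen L LF) (u : V) : V := rho g u - rho1 g u.

Lemma rho_split g u : rho g u = rho1 g u + rho2 g u.
Proof. by rewrite /rho2 addrC subrK. Qed.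

Lemma rho2_islinear g : islinear (rho2 g).
Proof.
move=> k x y; rewrite /rho2 (rep_islinear hrep) rho1_islinear scalerBr opprD.
by rewrite addrACA.
Qed.

Lemma rho2_tm g a b x : rho2 g (tm a b x) = tm a b (rho2 g x).
Proof.
rewrite /rho2 (islinearB (tm_islinear a b)).
have /eqP := rho_tm g a b x; rewrite -rho1_tm subr_eq => /eqP ->.
by rewrite [LHS]addrC addrA [X in X + _]addrA addNr add0r addrC.
Qed.

Lemma rho2_munit a b u : rho2 (munit a b) u = ((a == b)%:R * c%:C%C) *: u.
Proof. by rewrite /rho2 rho1_munit /tm opprB addrC subrK. Qed.

Lemma local_rho2 g n u : local n u -> local n (rho2 g u).
Proof. by move=> lu a b nb; rewrite -rho2_tm lu // (islinear0 (rho2_islinear g)). Qed.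

(** [rho2 k] commutes with each twisted unit and preserves locality, so one ball serves both [u] and
    its image. *)
Lemma rho1_rho2 g k u : rho1 g (rho2 k u) = rho2 k (rho1 g u).
Proof.
have lu := locdegP u.
rewrite (rho1E g lu) (rho1E g (local_rho2 k lu)) (islinear_sum (rho2_islinear k)).
apply: eq_bigr => e _; rewrite (islinear_sum (rho2_islinear k)).
by apply: eq_bigr => a _; rewrite rho2_tm.
Qed.

Lemma rhoC_split a u : rhoC rho a u = rhoC rho1 a u + rhoC rho2 a u.
Proof.
by rewrite /rhoC -big_split; apply: eq_bigr => p _; rewrite rho_split scalerDr.
Qed.

Lemma rhoC_islinear (r : gen L LF -> V -> V) a :
  (forall g, islinear (r g)) -> islinear (rhoC r a).
Proof.
move=> rlin k x y; rewrite /rhoC scaler_sumr -big_split; apply: eq_bigr => p _ /=.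
by rewrite rlin scalerDr !scalerA mulrC.
Qed.

Lemma rhoC_commute (r : gen L LF -> V -> V) (D : V -> V) a u : islinear D ->
  (forall g x, D (r g x) = r g (D x)) -> D (rhoC r a u) = rhoC r a (D u).
Proof.
move=> Dlin com; rewrite /rhoC (islinear_sum Dlin); apply: eq_bigr => p _.
by rewrite (islinearZ Dlin) com.
Qed.

Lemma rho2_is_rep : is_rep rho2.
Proof.
split=> [g|a b d abd u]; first exact: rho2_islinear.
have lin1 a' := rhoC_islinear a' rho1_islinear.
have lin2 a' := rhoC_islinear a' rho2_islinear.
have com a' b' : rhoC rho1 a' (rhoC rho2 b' u) = rhoC rho2 b' (rhoC rho1 a' u).
  apply: rhoC_commute => // g x; symmetry; apply: rhoC_commute; first exact: rho2_islinear.
  by move=> k y; rewrite rho1_rho2.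
have := hrep.2 a b d abd u; rewrite !rhoC_split -(rho1_is_rep.2 _ _ _ abd).
rewrite !(islinearD (lin1 _)) !(islinearD (lin2 _)) !com => e.
apply: (addrI (rhoC rho1 a (rhoC rho1 b u) - rhoC rho1 b (rhoC rho1 a u))); rewrite -e.
(* [Q] and [S] are the mixed terms, which agree on both sides because [rho1] and [rho2] commute. *)
have cancel (P Q S T P' T' : V) :
    P + Q + (S + T) - (P' + S + (Q + T')) = P - P' + (T - T').
  rewrite (addrACA P') opprD (addrACA (P + Q)) (opprD P') (addrACA P) subrr addr0.
  by rewrite (opprD S) (addrACA S) subrr add0r.
exact/esym/cancel.
Qed.

End Twist.
Arguments locdegP {R L LF V rho c} loc u.


(** * Adjoints of the two actions and the triangular decomposition *)

Section TwistForm.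
Variables (R : realType) (L LF : nat) (V : lmodType R[i]) (rho : gen L LF -> V -> V).
Hypothesis hrep : is_rep rho.
Variables (form : V -> V -> R[i]) (h : gen L LF -> R) (v : V).
Hypothesis hf : hermitian_pd form.
Hypothesis adj : forall g u w, form (rho g u) w = form u (rho (omega g) w).
Hypothesis hv : lowest_weight_vector rho h v.
Hypothesis vgen : generates rho v.
Variables (c : R) (N : nat).
Hypothesis hN : forall b, (N <= deg b)%N -> h (munit b b) = c.
Local Notation M a b := (rho (munit a b)).
Local Notation basis := (basis L LF).
Local Notation ball := (ball L LF).
Local Notation tm := (tm rho c).
Local Notation local := (local rho c).
Local Notation hw b := (h (munit b b)).

Lemma tm_adj a b u w : form (tm a b u) w = form u (tm b a w).
Proof.
rewrite /tm (formBl hf) (formBr hf) (formZl hf) (formZr hf) adj omega_munit.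
by rewrite eq_sym rmorphM /= conjc_nat oppr0.
Qed.

(** On the diagonal the weight is [c]; lowering units kill [v]; a raising unit joins two indices of
    weight [c], so by [norm_raising] its image has norm 0. *)
Lemma local_lw : local N v.
Proof.
move=> a b Nb; rewrite /tm; case/or3P: (bless_total a b) => [/eqP ->|ab|ba].
- by rewrite eqxx (lw_diag hv) hN // mul1r subrr.
- by rewrite (lw_neg hv ab) (bless_neq ab) mul0r scale0r subrr.
rewrite eq_sym (bless_neq ba) mul0r scale0r subr0; apply: (form_eq0 hf).
rewrite (norm_raising hrep hf adj (lw_neg hv ba) (lw_diag hv b) (lw_diag hv a)).
by rewrite !hN ?subrr ?mul0r // (leq_trans Nb (bless_deg ba)).
Qed.

Lemma local_all u : exists n, local n u.
Proof.
apply: (vgen (S := fun u => exists n, local n u)); last by exists N; exact: local_lw.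
split=> [|g x [n lx]]; last by exists (n + gen_shift g)%N; exact: local_rho.
split=> [|k x y [n lx] [m ly]]; first by exists 0%N; exact: (subspace0 (local_subspace hrep c 0)).
exists (maxn n m); apply: (local_subspace hrep c _).2.
  exact: (local_mono (leq_maxl n m) lx).
exact: (local_mono (leq_maxr n m) ly).
Qed.

Local Notation rho1 := (rho1 local_all).
Local Notation rho2 := (rho2 local_all).

(** Adjunction lets the locality of [w] bound the rows as that of [u] bounds the columns. The
    resulting finite square sum can be transposed. *)
Lemma form_rho1 g n u w : local n u -> local n w ->
  form (rho1 g u) w = \sum_(e <- ball n) \sum_(a <- ball n)
    form (tm a e u) w *+ count_mem a (gact g e).
Proof.
move=> lu lw; rewrite (rho1E local_all g lu) (form_suml hf); apply: eq_bigr => e _.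
rewrite (form_suml hf); apply: sum_count_seq; first exact: ball_uniq.
by move=> a _; rewrite mem_ball -leqNgt => na; rewrite tm_adj lw // (form0r hf).
Qed.

Lemma rho1_adj g u w : form (rho1 g u) w = form u (rho1 (omega g) w).
Proof.
pose n := maxn (locdeg local_all u) (locdeg local_all w).
have lu : local n u by exact: (local_mono (leq_maxl _ _) (locdegP local_all u)).
have lw : local n w by exact: (local_mono (leq_maxr _ _) (locdegP local_all w)).
rewrite (form_conj hf u) (form_rho1 g lu lw) (form_rho1 _ lw lu) exchange_big rmorph_sum.
apply: eq_bigr => a _ /=; rewrite rmorph_sum; apply: eq_bigr => e _ /=.
by rewrite rmorphMn /= -(form_conj hf) count_gact_omega tm_adj.
Qed.

Lemma rho2_adj g u w : form (rho2 g u) w = form u (rho2 (omega g) w).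
Proof. by rewrite /rho2 (formBl hf) (formBr hf) adj rho1_adj. Qed.

(** Stated for twisted units only, with the weights of [v]: all that [rho1] sees. *)
Definition lowest (y : V) : Prop :=
  (forall a b, bless a b -> tm a b y = 0) /\
  (forall b, tm b b y = (hw b - c)%:C%C *: y).

Lemma lowest_lw : lowest v.
Proof.
split=> [a b ab|b]; first by rewrite /tm (lw_neg hv ab) (bless_neq ab) mul0r scale0r subrr.
by rewrite /tm (lw_diag hv) eqxx mul1r -scalerBl -rmorphB.
Qed.

Lemma lowest_subspace : subspace lowest.
Proof.
split=> [|k x y [lx dx] [ly dy]].
  by split=> [a b _|b]; rewrite (islinear0 (tm_islinear hrep c _ _)) ?scaler0.
split=> [a b ab|b]; rewrite (tm_islinear hrep); first by rewrite lx // ly // scaler0 addr0.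
by rewrite dx dy scalerDr !scalerA mulrC.
Qed.

Lemma lowest_orbit y : orbit rho2 v y -> lowest y.
Proof.
move=> [P aP ->]; apply: (opalg_stable lowest_subspace _ aP lowest_lw) => g x [lx dx].
split=> [a b ab|b]; rewrite -(rho2_tm hrep); 
  first by rewrite lx // (islinear0 (rho2_islinear hrep _ g)).
by rewrite dx (islinearZ (rho2_islinear hrep _ g)).
Qed.

(** The value 0 at pairs that do not raise lets all pairs serve as indices. *)
Definition raise (p : basis * basis) (x : V) : V :=
  if bless p.2 p.1 then tm p.1 p.2 x else 0.

(* With [form_raise], the triangular decomposition: modulo the image of the
   raising operators, any product of [tm]'s acts on lowest vectors as a scalar. *)
Lemma tm_raise Q : opalg raise Q -> forall a b,
  exists2 Q', opalg raise Q' & forall y, lowest y -> tm a b (Q y) = Q' y.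
Proof.
pose stable Q := opalg raise Q /\ forall a b,
  exists2 Q', opalg raise Q' & forall y, lowest y -> tm a b (Q y) = Q' y.
have zero : opalg raise (fun x => (-1 : R[i]) *: x + x) by apply: opalg_lin; exact: opalg_id.
have zeroE (x : V) : (-1 : R[i]) *: x + x = 0 by rewrite scaleN1r addNr.
have stable_id : stable id.
  split; first exact: opalg_id.
  move=> a b; case/or3P: (bless_total a b) => [/eqP ->|ab|ba].
  - exists (fun x => (hw b - c)%:C%C *: x + ((-1 : R[i]) *: x + x)).
      exact: opalg_lin (opalg_id _) zero.
    by move=> y [_ dy]; rewrite dy zeroE addr0.
  - by exists (fun x => (-1 : R[i]) *: x + x) => // y [ly _]; rewrite ly // zeroE.
  - by exists (raise (a, b)); [exact: opalg_gen|rewrite /raise /= ba].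
have stable_lin k P Q1 : stable P -> stable Q1 -> stable (fun x => k *: P x + Q1 x).
  move=> [aP sP] [aQ sQ]; split; first exact: opalg_lin.
  move=> a b; have [P' aP' eP] := sP a b; have [Q' aQ' eQ] := sQ a b.
  exists (fun x => k *: P' x + Q' x); first exact: opalg_lin.
  by move=> y ly; rewrite (tm_islinear hrep) eP // eQ.
have stable_raise p P : stable P -> stable (fun x => raise p (P x)).
  move=> [aP sP]; split; first exact: opalg_comp (opalg_gen _ p) aP.
  case: p => d e a b; have [de|nde] := boolP (bless e d); last first.
    exists (fun x => (-1 : R[i]) *: x + x) => // y _; rewrite zeroE /raise /= (negbTE nde).
    exact: islinear0 (tm_islinear hrep c a b).
  (* [E'_ab E'_de = E'_de E'_ab + delta_bd E'_ae - delta_ea E'_db], and each unit on the right acts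
     on [P y] by the induction hypothesis. *)
  have [Q1 a1 e1] := sP a b; have [Q2 a2 e2] := sP a e; have [Q3 a3 e3] := sP d b.
  exists (fun x => (- (e == a)%:R) *: Q3 x + ((b == d)%:R *: Q2 x + raise (d, e) (Q1 x))).
    apply: opalg_lin => //; apply: opalg_lin => //.
    exact: opalg_comp (opalg_gen _ (d, e)) a1.
  move=> y ly; rewrite /raise /= de -e1 // -e2 // -e3 // scaleNr.
  have /eqP := tm_bracket hrep c a b d e (P y); rewrite subr_eq => /eqP ->.
  by rewrite [RHS]addrA; congr (_ + _); rewrite [RHS]addrC.
(* Composing with an arbitrary stable [Q1] on the right is the generality that the induction over
   products asks for. *)
suff stable_comp P : opalg raise P -> forall Q1, stable Q1 -> stable (fun x => P (Q1 x)).
  by move=> aQ; have [] := stable_comp _ aQ _ stable_id.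
elim=> [Q1 //|p Q1 /stable_raise //|P1 P2 _ IH1 _ IH2 Q1 sQ|k P1 P2 _ IH1 _ IH2 Q1 sQ].
  exact/IH1/IH2.
by apply: stable_lin; [exact: IH1|exact: IH2].
Qed.

(** An outermost raising unit becomes, on the other side, a lowering one and kills [y']. Only a
    constant term survives, the same for all [y] and [y']. *)
Lemma form_raise P : opalg raise P ->
  exists k, forall y y', lowest y -> lowest y' -> form (P y) y' = k * form y y'.
Proof.
pose good Q := exists k, forall y y', lowest y -> lowest y' ->
  form (Q y) y' = k * form y y'.
suff comp Q : opalg raise Q -> forall Q1, good Q1 -> good (fun x => Q (Q1 x)).
  by move=> aP; apply: (comp P aP id); exists 1 => y y' _ _; rewrite mul1r.
elim=> [Q1 //|[a b] Q1 _|P1 P2 _ IH1 _ IH2 Q1 gQ|k P1 P2 _ IH1 _ IH2 Q1 gQ].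
- exists 0 => y y' _ [ly' _]; rewrite mul0r /raise /=; case: ifP => [ba|_].
    by rewrite tm_adj ly' // (form0r hf).
  by rewrite (form0l hf).
- exact/IH1/IH2.
- have [k1 e1] := IH1 _ gQ; have [k2 e2] := IH2 _ gQ.
  exists (k * k1 + k2) => y y' ly ly'.
  by rewrite (formDl hf) (formZl hf) e1 // e2 // mulrA -mulrDl.
Qed.

(** One [Q'] must serve both vectors, so that they share the constant of [form_raise]; a ball common
    to both makes [rho1 g] the same finite sum of units on each. *)
Lemma opalg_rho1_raise P : opalg rho1 P -> forall y w, lowest y -> lowest w ->
  forall Q, opalg raise Q ->
  exists Q', [/\ opalg raise Q', P (Q y) = Q' y & P (Q w) = Q' w].
Proof.
move=> aP y w ly lw; elim: aP => [|g|P1 P2 _ IH1 _ IH2|k P1 P2 _ IH1 _ IH2] Q aQ.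
- by exists Q.
- pose n := maxn (locdeg local_all (Q y)) (locdeg local_all (Q w)).
  have lQy : local n (Q y) by exact: (local_mono (leq_maxl _ _) (locdegP local_all (Q y))).
  have lQw : local n (Q w) by exact: (local_mono (leq_maxr _ _) (locdegP local_all (Q w))).
  suff [Q' aQ' eQ'] : exists2 Q', opalg raise Q' & forall z, lowest z ->
      \sum_(e <- ball n) \sum_(a <- gact g e) tm a e (Q z) = Q' z.
    by exists Q'; rewrite (rho1E _ g lQy) (rho1E _ g lQw) !eQ'.
  have sum_op (T : Type) (r : seq T) (F : T -> V -> V) :
      (forall t, exists2 Q', opalg raise Q' & forall z, lowest z -> F t z = Q' z) ->
      exists2 Q', opalg raise Q' & forall z, lowest z -> \sum_(t <- r) F t z = Q' z.
    move=> hF; elim: r => [|t r [Q1 a1 e1]].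
      exists (fun x => (-1 : R[i]) *: x + x); first by apply: opalg_lin; exact: opalg_id.
      by move=> z _; rewrite big_nil scaleN1r addNr.
    have [Q2 a2 e2] := hF t; exists (fun x => 1 *: Q2 x + Q1 x); first exact: opalg_lin.
    by move=> z lz; rewrite big_cons e1 // e2 // scale1r.
  apply: (sum_op _ _ (fun e z => \sum_(a <- gact g e) tm a e (Q z))) => e.
  by apply: (sum_op _ _ (fun a z => tm a e (Q z))) => a; exact: tm_raise.
- by have [Q2 [a2 -> ->]] := IH2 _ aQ; exact: IH1.
- have [Q1 [a1 -> ->]] := IH1 _ aQ; have [Q2 [a2 -> ->]] := IH2 _ aQ.
  by exists (fun x => k *: Q1 x + Q2 x); split=> //; exact: opalg_lin.
Qed.

Lemma factor_lowest P y y' : opalg rho1 P -> orbit rho2 v y -> orbit rho2 v y' ->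
  form (P y) y' * form v v = form (P v) v * form y y'.
Proof.
move=> aP /lowest_orbit ly /lowest_orbit ly'; have lv := lowest_lw.
have [Q [aQ -> ->]] := opalg_rho1_raise aP ly lv (opalg_id _).
have [k ek] := form_raise aQ.
by rewrite !ek // mulrAC.
Qed.

(** For diagonal [g] every member of [gact g e] is [e], so its size is the entry [X_ee]. *)
Definition weight1 (g : gen L LF) : R :=
  \sum_(e <- ball N) (size (gact g e))%:R * (hw e - c).

Lemma rho1_lowest_weight : lowest_weight_vector rho1 weight1 v.
Proof.
split; first exact: lw_neq0 hv.
split=> g hg; rewrite (rho1E _ g local_lw).
  rewrite big1 // => e _; rewrite big_seq big1 // => a ae.
  by case: lowest_lw => lv _; apply: lv; exact: gact_negative ae.
rewrite /weight1 rmorph_sum scaler_suml; apply: eq_bigr => e _ /=.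
rewrite rmorphM /= rmorph_nat -scalerA scaler_nat.
transitivity (\sum_(a <- gact g e) (hw e - c)%:C%C *: v).
  rewrite !big_seq; apply: eq_bigr => a ae; rewrite (gact_diagonal hg ae).
  by case: lowest_lw.
by rewrite big_const_seq count_predT iter_addr_0.
Qed.

Lemma rho2_lowest_weight : lowest_weight_vector rho2 (fun g => h g - weight1 g) v.
Proof.
have [v0 [neg1 diag1]] := rho1_lowest_weight; have [_ [neg diag]] := hv.
split=> //; split=> g hg; rewrite /rho2; first by rewrite neg // neg1 // subrr.
by rewrite diag // diag1 // -scalerBl -rmorphB.
Qed.

Lemma rho2_first_kind (a : comb R L LF) : all (fun p => first_kind p.2) a ->
  exists k, forall x, rhoC rho2 a x = k *: x.
Proof.
elim: a => [|[z g] a IH] /=; first by exists 0 => x; rewrite /rhoC big_nil scale0r.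
case: g => // l1 l2 I0 J0 l3 l4 /= /IH[k ek].
exists (z * (((l1, I0, l3) == (l2, J0, l4))%:R * c%:C%C) + k) => x.
rewrite /rhoC big_cons -/(rhoC _ _ _) ek scalerDl -scalerA; congr (_ *: _ + _).
exact: (@rho2_munit _ _ _ _ _ _ local_all (l1, I0, l3) (l2, J0, l4)).
Qed.

(** Under [rho2] all of gl(infinity) acts by scalars, and scalars commute. *)
Lemma rho2_sl_trivial : sl_acts_trivially rho2.
Proof.
move=> a b d ha hb abd x; rewrite -((rho2_is_rep hrep local_all).2 _ _ _ abd).
have [k ek] := rho2_first_kind ha; have [k' ek'] := rho2_first_kind hb.
by rewrite !ek !ek' !scalerA mulrC subrr.
Qed.
End TwistForm.


(** * Approximate finiteness and the main theorem *)

Section ApproximatelyFinite.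
Variables (R : realType) (L LF : nat) (h : gen L LF -> R) (c : R) (N : nat).
Local Notation basis := (basis L LF).
Local Notation hw b := (h (munit b b)).
Hypothesis hN : forall b, (N <= deg b)%N -> hw b = c.

Lemma weight1_munit (b : basis) : weight1 h c N (munit b b) = hw b - c.
Proof.
pose F e := (size (gact (munit b b) e))%:R * (hw e - c).
have F0 e : e != b -> F e = 0 by rewrite /F gact_munit => /negbTE ->; rewrite mul0r.
have Fb : F b = hw b - c by rewrite /F gact_munit eqxx mul1r.
rewrite /weight1 -/F -Fb; have [bN|bN] := boolP (b \in ball L LF N).
  by rewrite (bigD1_seq b) ?ball_uniq //= big1 ?addr0.
rewrite Fb hN ?subrr; last by move: bN; rewrite mem_ball -leqNgt.
by rewrite big_seq big1 // => e eN; apply: F0; apply: contraNneq bN => <-.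
Qed.

(** Common form of the three summation conditions: [phi] sends a summation index to a basis vector
    [b], and the indices over [b] number [X_bb]. Vectors outside the ball contribute 0. *)
Lemma fin_sum_weight1 (T : eqType) (g : gen L LF) (phi : T -> basis)
    (fiber : basis -> seq T) :
  (forall b, uniq (fiber b)) -> (forall b p, (p \in fiber b) = (phi p == b)) ->
  (forall b, size (fiber b) = size (gact g b)) ->
  fin_sum (fun p => weight1 h c N (munit (phi p) (phi p))) (weight1 h c N g).
Proof.
move=> ufib mfib sfib; exists (flatten [seq fiber b | b <- ball L LF N]); split; last split.
- elim: (ball L LF N) (ball_uniq L LF N) => //= b s IH /andP[bs us].
  rewrite cat_uniq ufib IH // andbT; apply/hasPn => p /flattenP[_ /mapP[b' b's ->]].
  rewrite !mfib => /eqP ->; apply: contraNN bs => /eqP <-; exact: b's.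
- move=> p; rewrite weight1_munit => p0; apply/flattenP; exists (fiber (phi p)).
    apply: map_f; rewrite mem_ball ltnNge; apply: contraNN p0 => /hN ->.
    by rewrite subrr.
  by rewrite mfib.
- rewrite big_flatten big_map /weight1; apply: eq_bigr => b _.
  rewrite -sfib big_seq (eq_bigr (fun _ => hw b - c)) => [|p]; last first.
    by rewrite mfib => /eqP ->; exact: weight1_munit.
  by rewrite -big_seq big_const_seq count_predT iter_addr_0 mulr_natl.
Qed.

Lemma drop_size_inj (T : Type) (K : seq T) n m : (n <= size K)%N -> (m <= size K)%N ->
  drop n K = drop m K -> n = m.
Proof. by move=> nK mK /(congr1 size); rewrite !size_drop; lia. Qed.

Lemma take_size_inj (T : Type) (K : seq T) n m : (n <= size K)%N -> (m <= size K)%N ->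
  take n K = take m K -> n = m.
Proof. by move=> nK mK /(congr1 size); rewrite !size_takel. Qed.

(** In each summation condition the fiber over a basis vector lists the ways to cut its word around
    [I0]; these are the terms in the action of the diagonal generator. *)
Lemma weight1_approx_finite :
  (forall a b, bless a b -> exists n : nat, hw a - hw b = n%:R) ->
  approx_finite (weight1 h c N).
Proof.
move=> hnat; split; last split; last split.
- move=> l1 l2 l3 l4 I0 J0 gt.
  rewrite (weight1_munit (l1, I0, l2)) (weight1_munit (l3, J0, l4)).
  (* The shift by [c] cancels in a difference of weights. *)
  have /hnat[n e] : bless (l1, I0, l2) (l3, J0, l4).
    rewrite /bless /=; case: ltngtP => //=; move: gt.
    rewrite /seqgt !size_cat !size_map /= ltn_add2r eqn_add2r.
    by case: ltngtP.
  by exists n; rewrite opprB addrA subrK.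
- move=> l I0; pose phi (p : seq 'I_L * 'I_LF) : basis := (l, I0 ++ p.1, p.2).
  pose fiber (b : basis) : seq (seq 'I_L * 'I_LF) := let: (l5, K, l6) := b in
    if l5 == l then [seq (drop n K, l6) | n <- cuts2 (size K) & take n K == I0] else [::].
  apply: (@fin_sum_weight1 _ _ phi fiber) => [[[l5 K] l6]|[[l5 K] l6] [K' l']|[[l5 K] l6]];
    rewrite /fiber /gact; case: (l5 =P l) => e //.
  + rewrite map_inj_in_uniq ?filter_uniq ?iota_uniq // => n m.
    rewrite !mem_filter !mem_cuts2 => /andP[_ nK] /andP[_ mK] [].
    exact: drop_size_inj.
  + rewrite e; apply/mapP/eqP => [[n + [-> ->]]|[<- <-]].
      by rewrite /phi mem_filter => /andP[/eqP <- _]; rewrite cat_take_drop.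
    exists (size I0); last by rewrite drop_size_cat.
    by rewrite mem_filter take_size_cat // eqxx mem_cuts2 size_cat leq_addr.
  + by rewrite in_nil; apply/esym/eqP => -[el]; case: e.
  + by rewrite !size_map.
- move=> I0 l; pose phi (p : 'I_LF * seq 'I_L) : basis := (p.1, p.2 ++ I0, l).
  pose fiber (b : basis) : seq ('I_LF * seq 'I_L) := let: (l5, K, l6) := b in
    if l6 == l then [seq (l5, take n K) | n <- cuts2 (size K) & drop n K == I0] else [::].
  apply: (@fin_sum_weight1 _ _ phi fiber) => [[[l5 K] l6]|[[l5 K] l6] [l' K']|[[l5 K] l6]];
    rewrite /fiber /gact; case: (l6 =P l) => e //.
  + rewrite map_inj_in_uniq ?filter_uniq ?iota_uniq // => n m.
    rewrite !mem_filter !mem_cuts2 => /andP[_ nK] /andP[_ mK] [].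
    exact: take_size_inj.
  + rewrite e; apply/mapP/eqP => [[n + [-> ->]]|[<- <-]].
      by rewrite /phi mem_filter => /andP[/eqP <- _]; rewrite cat_take_drop.
    exists (size K'); last by rewrite take_size_cat.
    by rewrite mem_filter drop_size_cat // eqxx mem_cuts2 size_cat leq_addr.
  + by rewrite in_nil; apply/esym/eqP => -[_ _ el]; case: e.
  + by rewrite !size_map.
- move=> I0; pose phi (p : 'I_LF * seq 'I_L * seq 'I_L * 'I_LF) : basis :=
    (p.1.1.1, p.1.1.2 ++ I0 ++ p.1.2, p.2).
  pose fiber (b : basis) : seq ('I_LF * seq 'I_L * seq 'I_L * 'I_LF) :=
    let: (l5, K, l6) := b in
    [seq (l5, take nm.1 K, drop nm.2 K, l6)
      | nm <- cuts3 (size K) & take (nm.2 - nm.1) (drop nm.1 K) == I0].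
  apply: (@fin_sum_weight1 _ _ phi fiber)
    => [[[l5 K] l6]|[[l5 K] l6] [[[l1 K1] K3] l3]|[[l5 K] l6]]; rewrite /fiber /gact.
  + rewrite map_inj_in_uniq; first exact/filter_uniq/cuts3_uniq.
    move=> [n m] [n' m'].
    rewrite mem_filter mem_cuts3 => /and3P[_ nm mK].
    rewrite mem_filter mem_cuts3 => /and3P[_ nm' mK'] /= [en em]; rewrite /= in nm mK nm' mK'.
    by congr pair; [apply: take_size_inj en|apply: drop_size_inj em]; lia.
  + apply/mapP/eqP => [[[n m] + [-> -> -> ->]]|[<- <- <-]].
      rewrite mem_filter mem_cuts3 => /and3P[/eqP eI nm _].
      by rewrite /phi /= -(take_cut3 nm eI).
    exists (size K1, size K1 + size I0)%N; last first.
      by rewrite /= take_size_cat // catA drop_size_cat // size_cat.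
    rewrite mem_filter mem_cuts3 [X in X && _]/= [X in _ && (X <= _)%N]/=.
    rewrite drop_size_cat // addKn take_size_cat // eqxx.
    by rewrite leq_addr !size_cat addnA leq_addr.
  + by rewrite !size_map.
Qed.
End ApproximatelyFinite.

Theorem theorem2 (R : realType) (L LF : nat) (hL : (0 < L)%N) (hLF : (0 < LF)%N)
  (V : lmodType R[i]) (rho : gen L LF -> V -> V) :
  is_rep rho -> unitary rho -> irreducible rho -> lowest_weight_rep rho ->
  exists (V1 V2 : lmodType R[i]) (rho1 : gen L LF -> V1 -> V1)
         (rho2 : gen L LF -> V2 -> V2) (beta : V1 -> V2 -> V),
    tensor_rep_iso rho1 rho2 rho beta /\
    (is_rep rho1 /\ unitary rho1 /\ irreducible rho1 /\
     exists h1 : gen L LF -> R, lowest_weight_rep_with rho1 h1 /\ approx_finite h1) /\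
    (is_rep rho2 /\ unitary rho2 /\ irreducible rho2 /\ lowest_weight_rep rho2 /\
     sl_acts_trivially rho2).
Proof.
move=> hrep /unitaryP[form [hf adj]] irr [h [v [hv vgen]]].
(* Positivity of [L] and [LF] supplies the letter and the end index of the chain. *)
have [c [N hN]] := weight_eventually_const hrep hf adj hv (Ordinal hL) (Ordinal hLF).
pose loc := local_all hrep hf adj hv vgen hN.
have v0 : v != 0 := lw_neq0 hv.
have lin1 := rho1_islinear hrep loc; have lin2 := rho2_islinear hrep loc.
have com := rho1_rho2 hrep loc; have split_rho := rho_split loc.
have adj1 := rho1_adj hrep hf adj hv vgen hN.
have adj2 := rho2_adj hrep hf adj hv vgen hN.
have fac := @factor_lowest _ _ _ _ _ hrep _ _ _ hf adj hv vgen _ _ hN.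
exists (subspace_of (orbit_subspace (rho1 loc) v)), (subspace_of (orbit_subspace (rho2 loc) v)).
exists (@factor1 _ _ _ _ (rho1 loc) v), (@factor2 _ _ _ _ (rho2 loc) v).
exists (@beta _ _ _ _ (rho1 loc) (rho2 loc) v).
split; first split.
- exact: (beta_tensor_product hf v0 lin1 lin2 com adj1 split_rho irr fac).
- by move=> g x y; apply: rho_beta.
split; (split; [|split; [|split]]).
- exact/restr_is_rep/rho1_is_rep.
- exact: restr_unitary hf adj1.
- exact: (factor1_irreducible hf v0 lin1 lin2 com adj1 split_rho irr fac).
- exists (weight1 h c N); split; last first.
    apply: (weight1_approx_finite hN) => a b.
    exact: (weight_difference_nat hrep hf adj hv).
  exists (vac1 (rho1 loc) v); split; last exact: factor1_generates.
  exact/restr_lowest_weight/rho1_lowest_weight.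
- exact/restr_is_rep/rho2_is_rep.
- exact: restr_unitary hf adj2.
- exact: (factor2_irreducible hf v0 lin1 lin2 com adj1 split_rho irr fac).
- split.
    exists (fun g => h g - weight1 h c N g), (vac2 (rho2 loc) v).
    split; last exact: factor2_generates.
    exact/restr_lowest_weight/rho2_lowest_weight.
  move=> a b d ha hb abd x; apply: val_inj; rewrite val_rhoC_restr linear0.
  exact: (rho2_sl_trivial hrep hf adj hv vgen hN ha hb abd).
Qed.
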